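(* Let $m,n$ be positive integers and let $\|\cdot\|_1$ and $\|\cdot\|_2$ be arbitrary norms on $\mathbb{R}^n$ and $\mathbb{R}^m$, respectively. Then there exists $c_0=c_0(m,n,\|\cdot\|_1,\|\cdot\|_2)>0$ so that for any $c\in[0,c_0]$ the following hold. (a) If $m\ne n$ and $(m,n)\ne(1,3)$, then $$\dim_H FS_{m,n}(\|\cdot\|_1,\|\cdot\|_2,c)\ \ge\ m(n-2).$$ For $m=n$ we still have $$\dim_H DI_{n,n}(\|\cdot\|_1,\|\cdot\|_2,c)\ \ge\ n(n-2).$$ (b) If $m>n$, we have the stronger bound $$\dim_H FS_{m,n}(\|\cdot\|_1,\|\cdot\|_2,c)\ \ge\ m(n-1).$$
   Context: For norms $\|\cdot\|_1$ on $\mathbb{R}^n$ and $\|\cdot\|_2$ on $\mathbb{R}^m$, $\Omega\in\mathbb{R}^{m\times n}$ and $t\ge1$ let $$\psi_\Omega(t)=\min\{\|\Omega\hat{\boldsymbol b}+\tilde{\boldsymbol b}\|_2:\hat{\boldsymbol b}\in\mathbb{Z}^n,\ \tilde{\boldsymbol b}\in\mathbb{Z}^m,\ 1\le\|\hat{\boldsymbol b}\|_1\le t\},$$ $\Theta(\Omega)=\limsup_{t\to\infty}t^{n/m}\psi_\Omega(t)$ and $\widetilde\Theta(\Omega)=\liminf_{t\to\infty}t^{n/m}\psi_\Omega(t)$. Put $DI_{m,n}(\|\cdot\|_1,\|\cdot\|_2,c)=\{\Omega\in\mathbb{R}^{m\times n}:\Theta(\Omega)=c\}$, $Bad_{m,n}=\{\Omega:\widetilde\Theta(\Omega)>0\}$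 (independent of the norms), and for $c\ge0$ $$FS_{m,n}(\|\cdot\|_1,\|\cdot\|_2,c)=DI_{m,n}(\|\cdot\|_1,\|\cdot\|_2,c)\setminus Bad_{m,n}.$$ $\dim_H$ denotes Hausdorff dimension. *)

(* Defs.v *)
From HB Require Import structures.
From mathcomp Require Import all_boot all_order all_algebra.
From mathcomp Require Import zify.
From mathcomp Require Import all_classical all_reals all_analysis.

Set Implicit Arguments.
Unset Strict Implicit.
Unset Printing Implicit Defensive.

Import Order.TTheory GRing.Theory Num.Theory.
Import numFieldNormedType.Exports.

Local Open Scope classical_set_scope.
Local Open Scope ring_scope.

Record is_norm (R : realType) (k : nat) (N : 'cV[R]_k -> R) : Prop := IsNorm {
  is_norm_ge0 : forall x, 0 <= N x;
  is_norm_eq0 : forall x, N x = 0 -> x = 0;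
  is_normZ : forall (a : R) x, N (a *: x) = `|a| * N x;
  is_normD : forall x y, N (x + y) <= N x + N y }.

Lemma ler_mx_coord (R : realType) p q (A : 'M[R]_(p, q)) i j :
  `|A i j| <= `|A|.
Proof.
rewrite [leRHS]/Num.norm /= mx_normrE; apply/bigmax_geP; right => /=.
by exists (i, j).
Qed.

Section norm_bounds.
Context {R : realType} {k : nat} {N : 'cV[R]_k -> R}.
Hypothesis nN : is_norm N.

Lemma is_norm0 : N 0 = 0.
Proof. by rewrite -(scale0r 0) (is_normZ nN) normr0 mul0r. Qed.

Lemma is_normN x : N (- x) = N x.
Proof. by rewrite -scaleN1r (is_normZ nN) normrN1 mul1r. Qed.

Lemma is_norm_upper : exists2 C : R, 0 < C &
  forall v : 'rV[R]_k, N v^T <= C * `|v|.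
Proof.
exists (1 + \sum_i N (delta_mx i 0)).
  by rewrite ltr_pwDl// sumr_ge0// => i _; exact: is_norm_ge0.
move=> v; have -> : v^T = \sum_i v 0 i *: delta_mx i 0.
  apply/colP => i; rewrite mxE summxE (bigD1 i)//= !mxE !eqxx mulr1.
  rewrite big1 ?addr0// => j ji.
  by rewrite !mxE eq_sym (negbTE ji) /= mulr0.
have sumN (I : seq 'I_k) : N (\sum_(i <- I) v 0 i *: delta_mx i 0) <=
    (\sum_(i <- I) N (delta_mx i 0)) * `|v|.
  elim: I => [|i I IH]; first by rewrite !big_nil is_norm0 mul0r.
  rewrite !big_cons mulrDl (le_trans (is_normD nN _ _))// lerD//.
  rewrite (is_normZ nN) mulrC ler_wpM2l ?(is_norm_ge0 nN)//.
  exact: ler_mx_coord.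
by rewrite (le_trans (sumN _))// ler_wpM2r// lerDr.
Qed.

Lemma is_norm_lower : exists2 C : R, 0 < C &
  forall v : 'rV[R]_k, `|v| <= C * N v^T.
Proof.
have [C C0 NC] := is_norm_upper.
pose g (v : 'rV[R]_k) := N v^T.
have gB v w : g v - g w <= C * `|v - w|.
  rewrite lerBlDr; apply: le_trans (lerD (NC _) (lexx _)).
  by rewrite -/(g (v - w)) /g -[in leLHS](subrK w v) linearD/= (is_normD nN).
have gcont : continuous g.
  move=> v; apply/(@cvgrPdist_le _ _ _ _ (nbhs_filter v)) => e e0.
  apply/nbhs_ballP.
  exists (C^-1 * e); first by rewrite /= mulr_gt0// invr_gt0.
  move=> w; rewrite -ball_normE /= => /ltW; rewrite ler_pdivlMl// => vw.
  rewrite ler_norml lerNl opprB; apply/andP; split; apply: le_trans vw => //.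
  by rewrite distrC.
pose S := [set v : 'rV[R]_k | `|v| = 1].
have [S0|/set0P S0] := eqVneq S set0.
  exists 1 => // v; have [->|v0] := eqVneq v 0.
    by rewrite normr0 mul1r (is_norm_ge0 nN).
  suff : S (`|v|^-1 *: v) by rewrite S0.
  by rewrite /S /= normrZ normfV normr_id mulVf// normr_eq0.
have cS : compact S.
  apply: bounded_closed_compact.
    by exists 1; split => // x x1 v /= ->; exact: ltW.
  have -> : S = (fun v : 'rV[R]_k => `|v|) @^-1` [set 1] by [].
  apply: preimage_closed; first by move=> v _; exact: norm_continuous.
  exact: closed_eq.
have [u] := compact_EVT_min S0 cS (continuous_subspaceT gcont).
rewrite inE => Su umin.
have gu0 : 0 < g u.
  rewrite lt_neqAle (is_norm_ge0 nN) andbT eq_sym.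
  apply/eqP => /(is_norm_eq0 nN)/(congr1 trmx); rewrite trmxK trmx0 => u0.
  by move: Su; rewrite /S /= u0 normr0 => /esym/eqP; rewrite oner_eq0.
exists (g u)^-1; first by rewrite invr_gt0.
move=> v; have [->|v0] := eqVneq v 0.
  by rewrite normr0 mulr_ge0 ?invr_ge0 ?(ltW gu0)// (is_norm_ge0 nN).
have v0' : 0 < `|v| by rewrite normr_gt0.
have : g u <= g (`|v|^-1 *: v).
  apply: umin; rewrite inE /S /= normrZ normfV normr_id mulVf//.
  by rewrite gt_eqF.
rewrite /g linearZ/= (is_normZ nN) normfV normr_id => H.
by rewrite mulrC ler_pdivlMr// mulrC -ler_pdivlMr// mulrC.
Qed.

Lemma finite_int_ball (r : R) :
  finite_set [set b : 'cV[int]_k | N (map_mx intr b) <= r].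
Proof.
have [C C0 NC] := is_norm_lower.
pose K := (Num.truncn (C * r)).+1.
pose f (M : 'cV['I_(K + K).+1]_k) : 'cV[int]_k :=
  map_mx (fun i : 'I_(K + K).+1 => (i : nat)%:Z - K%:Z) M.
apply: (@sub_finite_set _ _ (range f)); last first.
  exact/finite_image/finite_finset.
move=> b /= br.
have bK i : (`|b i 0| <= K%:Z).
  have : `|(map_mx intr b : 'cV[R]_k)^T| <= C * r.
    by rewrite (le_trans (NC _))// trmxK ler_wpM2l// ltW.
  move=> H; have := le_trans (ler_mx_coord _ 0 i) H.
  rewrite !mxE => bi; rewrite -(ler_int R) intr_norm.
  apply: le_trans bi _; rewrite -[leRHS]pmulrn.
  exact/ltW/truncnS_gt.
exists (map_mx (fun z : int => inord (absz (z + K%:Z))) b) => //.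
apply/colP => i; rewrite !mxE inordK.
  move: (bK i); lia.
move: (bK i); lia.
Qed.

End norm_bounds.

Section hausdorff.
Context {R : realType} {V : normedModType R}.
Local Open Scope ereal_scope.

Definition diam (U : set V) : \bar R :=
  ereal_sup [set (`|x.1 - x.2|%R)%:E | x in U `*` U].

(* The empty set is treated apart because ereal_sup set0 = -oo; nonempty sets
   of diameter 0 have weight 1 if s = 0 and weight 0 if s > 0. *)
Definition diam_pow (s : R) (U : set V) : \bar R :=
  if U == set0 then 0 else poweR (diam U) s.

Definition hausdorff_premeasure (s delta : R) (A : set V) : \bar R :=
  ereal_inf [set \sum_(0 <= i <oo) diam_pow s (U i) | U in
    [set U : (set V)^nat | A `<=` \bigcup_i U i /\
                           forall i, diam (U i) <= delta%:E]].

Definition hausdorff_measure (s : R) (A : set V) : \bar R :=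
  ereal_sup [set hausdorff_premeasure s delta A | delta in [set x | (0 < x)%R]].

Definition hausdorff_dim (A : set V) : \bar R :=
  ereal_inf [set s%:E | s in
    [set s : R | (0 <= s)%R /\ hausdorff_measure s A = 0]].

End hausdorff.

Section approximation.
Context {R : realType} {m n : nat}.
Variables (N1 : 'cV[R]_n -> R) (N2 : 'cV[R]_m -> R).

Definition psi_admissible (t : R) (b : 'cV[int]_n * 'cV[int]_m) : Prop :=
  1 <= N1 (map_mx intr b.1) <= t.

Definition psi_value (Omega : 'M[R]_(m, n)) (b : 'cV[int]_n * 'cV[int]_m) : R :=
  N2 (Omega *m map_mx intr b.1 + map_mx intr b.2).

(* Extended-valued because there may be no admissible vector for small t (the
   value is then +oo).  Otherwise it is a minimum, see psi_min below. *)
Definition psi (Omega : 'M[R]_(m, n)) (t : R) : \bar R :=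
  ereal_inf [set (psi_value Omega b)%:E | b in psi_admissible t].

Lemma finite_set_argmin (T : eqType) (f : T -> R) (A : set T) :
  A !=set0 -> finite_set A -> exists2 a, A a & forall b, A b -> f a <= f b.
Proof.
move=> [x0 Ax0] /finite_seqP[s As]; rewrite {A}As/= in Ax0 *.
elim: s x0 Ax0 => // x [|y s] IH x0 Ax0.
  by exists x; rewrite ?mem_head//= => b; rewrite inE => /eqP ->.
have [a ain amin] := IH y (mem_head _ _).
have [fax|fxa] := leP (f a) (f x).
  exists a; first by rewrite /= inE ain orbT.
  by move=> b /=; rewrite inE => /orP[/eqP -> //|]; exact: amin.
exists x; first exact: mem_head.
move=> b /=; rewrite inE => /orP[/eqP -> //|/amin].
exact/le_trans/ltW.
Qed.

Lemma psi_min (Omega : 'M[R]_(m, n)) (t : R) :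
  is_norm N1 -> is_norm N2 -> psi_admissible t !=set0 ->
  exists2 b, psi_admissible t b & psi Omega t = (psi_value Omega b)%:E /\
    forall b', psi_admissible t b' -> psi_value Omega b <= psi_value Omega b'.
Proof.
move=> n1 n2 [b0 b0t].
pose B := [set b | psi_admissible t b /\ psi_value Omega b <= psi_value Omega b0].
have finB : finite_set B.
  pose F1 := [set b : 'cV[int]_n | N1 (map_mx intr b) <= t].
  pose r b := psi_value Omega b0 + N2 (Omega *m map_mx intr b).
  pose F2 b := [set b' : 'cV[int]_m | N2 (map_mx intr b') <= r b].
  apply: (@sub_finite_set _ _ (\bigcup_(b in F1) ([set b] `*` F2 b))).
    move=> [b b'] [/andP[_ bt] bv]; exists b => //; split => //=.
    rewrite /F2 /r /= -[X in N2 X](addKr (Omega *m map_mx intr b)).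
    by rewrite addrC (le_trans (is_normD n2 _ _))// (is_normN n2) lerD.
  apply: bigcup_finite; first exact: finite_int_ball.
  by move=> b _; apply: finite_setX; [exact: finite_set1|exact: finite_int_ball].
have [|b [bt bv] bmin] := finite_set_argmin (psi_value Omega) _ finB.
  by exists b0; split.
have {}bmin b' : psi_admissible t b' -> psi_value Omega b <= psi_value Omega b'.
  move=> b't; have [b'0|/ltW] := leP (psi_value Omega b') (psi_value Omega b0).
    exact: bmin.
  exact: le_trans.
exists b => //; split=> //; apply/eqP; rewrite eq_le; apply/andP; split.
  by apply: ereal_inf_lbound; exists b.
by apply: le_ereal_inf_tmp => _ [b' b't <-]; rewrite lee_fin bmin.
Qed.

Definition scaled_psi (Omega : 'M[R]_(m, n)) (t : R) : \bar R :=
  ((t `^ (n%:R / m%:R))%:E * psi Omega t)%E.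

Definition Theta (Omega : 'M[R]_(m, n)) : \bar R :=
  limf_esup (scaled_psi Omega) +oo.

Definition Theta_low (Omega : 'M[R]_(m, n)) : \bar R :=
  limf_einf (scaled_psi Omega) +oo.

Definition DI (c : R) : set 'M[R]_(m, n) := [set Omega | Theta Omega = c%:E].

Definition Bad : set 'M[R]_(m, n) := [set Omega | (0 < Theta_low Omega)%E].

Definition FS (c : R) : set 'M[R]_(m, n) := DI c `\` Bad.

End approximation.

(* Main.v *)
Require Import Defs.
From mathcomp Require Import all_boot all_order all_algebra.
From mathcomp Require Import zify ring lra.
From mathcomp Require Import all_classical all_reals all_analysis.

(** Write [n = p + q] with [q = 1] if [n < m] and [q = 2] if [m <= n], and
    [Omega = (X | W)] with [X] of size [m x p] and [W] of size [m x q].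

    One fixed [W] is built as a limit of rational matrices having integer
    relations [b_k] of lengths [T_k].  The value of [b_k] at [W] is
    [c T_(k+1)^(-n/m)] up to a factor tending to 1, and no nonzero integer vector
    of length less than [T_(k+1)] does better at [W].  Used in [Omega], the
    vectors [(0, b_k)] give [Theta <= c], and [Theta_low = 0] because
    [T_(k+1) / T_k] is unbounded.

    [Theta >= c] also needs, for infinitely many [k], that no integer vector with a
    nonzero [X]-part and of length less than [T_(k+1)] does better than [b_k].
    There are about [T^n] such vectors, and each is better only on a proportion
    about [c^m T^(-n)] of [X].  So for small [c] the condition holds on at least
    half of every cube once [k] is large.  Nested cubes in which it holds
    infinitely often can then be chosen so as to avoid any cover of small [s]-mass
    with [s < m p], whence the lower bound [m p] for the dimension. *)

Set Implicit Arguments.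
Unset Strict Implicit.
Unset Printing Implicit Defensive.

Import Order.TTheory GRing.Theory Num.Theory.
Import numFieldNormedType.Exports.

Local Open Scope ring_scope.


(** Freezing [W] costs [m q] of the [m n] dimensions, so [q] should be minimal. One column suffices
    only for [n < m]: consecutive minimal relations of an irrational column are independent, hence
    the value of one is at least a constant over the length of the next, and [c T^(-n/m)] with small
    [c] is out of reach when [m <= n]. Two columns that carry the relation in turn escape this
    bound.

    At each stage the rational matrix has an exact relation, and the next stage moves the matrix
    just enough to give that relation the prescribed value. The finished peaks are open conditions,
    so they survive in the limit if later moves are small enough.

    Small [c] is used twice: in the count of bad [X], and in the construction of [W], where the
    prescribed value has to stay below the spacing of the competing values. The value [c = 0] is
    treated apart, with [W = 0]. For [n = 1], and for [m <= n = 2], the bounds to be proved are at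
    most 0. *)

Lemma powR_nat_unbounded (R : realType) (e K : R) : 0 < e ->
  exists N0 : nat, forall N, (N0 <= N)%N -> K <= N%:R `^ e.
Proof.
move=> e0; have [K0|K0] := leP K 0.
  by exists 0%N => N _; rewrite (le_trans K0)// powR_ge0.
exists (Num.truncn (K `^ e^-1)).+1 => N HN.
have -> : K = (K `^ e^-1) `^ e by rewrite -powRrM mulVf ?gt_eqF// powRr1// ltW.
apply: ge0_ler_powR; rewrite ?nnegrE ?powR_ge0//; first exact: ltW.
by rewrite (le_trans (ltW (truncnS_gt _)))// ler_nat.
Qed.

Lemma nested_intervals (R : realType) (lo hi : nat -> R) :
  (forall k j, lo k <= hi j) -> exists x, forall k, lo k <= x <= hi k.
Proof.
move=> H; exists (sup (range lo)) => k.
have ub : ubound (range lo) (hi k) by move=> _ [j _ <-].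
apply/andP; split; last by apply: ge_sup => //; exists (lo 0%N); exists 0%N.
by apply: ub_le_sup; [exists (hi k)|exists k].
Qed.

Lemma card_mx_entries (T : finType) p q (P : 'I_p -> 'I_q -> pred T) :
  (#|[set a : 'M[T]_(p, q) | [forall i, [forall j, P i j (a i j)]]]| <=
   \prod_i \prod_j #|P i j|)%N.
Proof.
pose F (x : 'I_p * 'I_q) := P x.1 x.2.
have -> : (\prod_i \prod_j #|P i j| = #|family F|)%N.
  rewrite card_family foldrE big_map.
  by rewrite pair_bigA /= big_enum.
pose h (a : 'M[T]_(p, q)) : {ffun 'I_p * 'I_q -> T} := [ffun x => a x.1 x.2].
have hI : injective h.
  by move=> a b /ffunP ab; apply/matrixP => i j; have := ab (i, j); rewrite !ffunE.
rewrite -(card_imset _ hI); apply: subset_leq_card.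
apply/fintype.subsetP => g /imsetP[a]; rewrite inE => /forallP Pa ->.
apply/familyP => -[i j]; rewrite ffunE; have /forallP := Pa i; exact.
Qed.

Lemma card_ord_near (R : realType) (N : nat) (s : 'I_N) (B : R) : 0 <= B ->
  (#|[pred t : 'I_N | (`|t%:R - s%:R : R| <= B)]|%:R <= 2 * B + 1 :> R).
Proof.
move=> B0; set b := Num.truncn B.
have bB : b%:R <= B by rewrite truncn_le.
apply: (@le_trans _ _ (2 * b + 1)%:R); last by rewrite natrD natrM; lra.
rewrite ler_nat.
have key (t : 'I_N) : `|t%:R - s%:R : R| <= B -> (s <= t + b)%N /\ (t <= s + b)%N.
  have : B < b.+1%:R by exact: truncnS_gt.
  move=> Bb; rewrite ler_norml => /andP[h1 h2]; split; rewrite -ltnS -(ltr_nat R).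
    by rewrite -addnS natrD; lra.
  by rewrite -addnS natrD; lra.
rewrite addn1.
pose h (t : 'I_N) : 'I_(2 * b).+1 := inord (t + b - s).
have hlt (t : 'I_N) : `|t%:R - s%:R : R| <= B -> (h t = t + b - s :> nat)%N.
  by move=> /key[? ?]; rewrite /h inordK//; lia.
rewrite -[leqRHS]card_ord -(card_in_imset (f := h)) ?max_card//.
move=> t u; rewrite !inE => Ht Hu /(congr1 val) /=; rewrite !hlt// => E.
apply: val_inj => /=; have [? ?] := key _ Ht; have [? ?] := key _ Hu; lia.
Qed.

Lemma powR_div (R : realType) (x y s : R) : 0 <= x -> 0 <= y ->
  (x / y) `^ s = x `^ s / y `^ s.
Proof.
move=> x0 y0; rewrite powRM ?invr_ge0//; congr (_ * _).
by rewrite -(powR_inv1 y0) -powRrM mulN1r powRN.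
Qed.

Lemma norm_le_entries (R : realType) k (N : 'cV[R]_k -> R) : is_norm N ->
  exists2 C : R, 0 < C & forall (v : 'cV[R]_k) mu,
    0 <= mu -> (forall i, `|v i 0| <= mu) -> N v <= C * mu.
Proof.
move=> nN; have [C C0 H] := is_norm_upper nN; exists C => // v mu mu0 Hv.
have := H v^T; rewrite trmxK => /le_trans; apply; rewrite ler_wpM2l ?(ltW C0)//.
rewrite [leLHS]/Num.norm /= mx_normrE; apply: bigmax_le => // -[i j] _ /=.
by rewrite mxE ord1.
Qed.

Lemma entries_le_norm (R : realType) k (N : 'cV[R]_k -> R) : is_norm N ->
  exists2 C : R, 0 < C & forall (v : 'cV[R]_k) i, `|v i 0| <= C * N v.
Proof.
move=> nN; have [C C0 H] := is_norm_lower nN; exists C => // v i.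
have := H v^T; rewrite trmxK; apply: le_trans.
by have := ler_mx_coord v^T 0 i; rewrite mxE.
Qed.

(** * Avoiding sparse sets by nested cubes *)


Section cubes.
Context {R : realType} {p q : nat}.
Implicit Types (l X : 'M[R]_(p, q)) (rho : R).

Definition cube l rho : set 'M[R]_(p, q) :=
  fun X => forall i j, l i j <= X i j <= l i j + rho.

Definition subcorner l rho N (a : 'M['I_N]_(p, q)) : 'M[R]_(p, q) :=
  \matrix_(i, j) (l i j + rho / N%:R * (a i j)%:R).

Definition meets (U : set 'M[R]_(p, q)) l rho : Prop :=
  exists2 X, U X & cube l rho X.

Lemma subcube_sub l rho N (a : 'M['I_N]_(p, q)) X : 0 < rho ->
  cube (subcorner l rho a) (rho / N%:R) X -> cube l rho X.
Proof.
move=> r0 aX i j; have /andP := aX i j; rewrite mxE => -[h1 h2].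
have aN : (a i j < N)%N by [].
have N0 : (0 : R) < N%:R by rewrite ltr0n (leq_trans _ aN).
have t0 : 0 < rho / N%:R by rewrite divr_gt0.
have aN' : (a i j)%:R + 1 <= N%:R :> R by rewrite natr1 ler_nat.
have Nt : rho / N%:R * N%:R = rho by rewrite divfK// gt_eqF.
have := ler_wpM2l (ltW t0) aN'; have : 0 <= rho / N%:R * (a i j)%:R.
  by rewrite mulr_ge0// ltW.
by move: h1 h2; set w := _ * (a i j)%:R; rewrite mulrDr mulr1 -/w Nt; lra.
Qed.

(** Every subcube met is compared with one fixed such subcube: with [t] the side of the subcubes,
    the integer positions differ by at most [d / t + 1] in each entry, which leaves at most
    [2 (d / t + 1) + 1] choices per entry. *)
Lemma card_meets (U : set 'M[R]_(p, q)) l rho N (d : R) : 0 < rho ->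
  (forall X Y, U X -> U Y -> forall i j, `|X i j - Y i j| <= d) -> 0 <= d ->
  (#|[pred a : 'M['I_N]_(p, q) |
       `[< meets U (subcorner l rho a) (rho / N%:R) >]]|)%:R <=
  (2 * (d / (rho / N%:R)) + 3) ^+ (p * q) :> R.
Proof.
move=> r0 Ud d0.
set t := rho / N%:R; have t0 : 0 <= t by rewrite divr_ge0// ltW.
have [/pred0P E|/pred0Pn[a0]] :=
    boolP (pred0b [pred a : 'M['I_N]_(p, q) | `[< meets U (subcorner l rho a) t >]]).
  rewrite (eq_card0 E) exprn_ge0// addr_ge0// mulr_ge0// divr_ge0//.
rewrite inE => /asboolP[Y UY aY].
have [pq0|pq0] := posnP (p * q).
  rewrite pq0 expr0 -[leRHS]/(1%:R) ler_nat (leq_trans (max_card _))//.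
  by rewrite card_mx pq0.
have N0 : (0 : R) < N%:R.
  have [i j] : 'I_p * 'I_q.
    by move: pq0; rewrite muln_gt0 => /andP[? ?]; split; [exists 0%N|exists 0%N].
  by rewrite ltr0n (leq_ltn_trans (leq0n _) (ltn_ord (a0 i j))).
have {}t0 : 0 < t by rewrite divr_gt0.
pose B := d / t + 1; have B0 : 0 <= B by rewrite addr_ge0// divr_ge0// ltW.
pose P (i : 'I_p) (j : 'I_q) := [pred s : 'I_N | (`|s%:R - (a0 i j)%:R : R| <= B)].
apply: (@le_trans _ _ (\prod_(i < p) \prod_(j < q) #|P i j|)%:R).
  rewrite ler_nat; apply: leq_trans (card_mx_entries P); apply: subset_leq_card.
  apply/fintype.subsetP => a; rewrite inE => /asboolP[X UX aX].
  apply/forallP => i; apply/forallP => j; rewrite /P /=.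
  have /andP := aX i j; have /andP := aY i j; rewrite !mxE -/t => -[h1 h2] [h3 h4].
  rewrite -(ler_pM2l t0) -{1}(gtr0_norm t0) -normrM mulrBr /B mulrDr mulr1.
  rewrite (mulrC t (d / t)) divfK ?gt_eqF//.
  have := Ud X Y UX UY i j; rewrite !ler_norml => /andP[h5 h6].
  by apply/andP; split; lra.
rewrite natr_prod mulnC exprM.
have -> : forall x : R, (x ^+ q) ^+ p = \prod_(i < p) \prod_(j < q) x.
  by move=> x; rewrite !prodr_const !card_ord.
apply: ler_prod => i _; rewrite ler0n natr_prod; apply: ler_prod => j _.
rewrite ler0n /=; apply: le_trans (card_ord_near _ B0) _.
by rewrite /B; lra.
Qed.

End cubes.

Section avoid.
Context {R : realType} {p q : nat}.
Variables (s : R) (s0 : 0 < s) (sd : s < (p * q)%:R).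
Variables (U : nat -> set 'M[R]_(p, q)) (f : nat -> R).
Hypothesis f0 : forall i, 0 < f i.
Hypothesis Uf : forall n X Y, U n X -> U n Y ->
  forall i j, `|X i j - Y i j| `^ s <= f n.

Let d := (p * q)%N.
Let kap : R := (8 * 5 ^+ d)^-1.

(** The invariant of the nested construction, scaled like the content of the cube in dimension [s].
    Bounding all partial sums stands for bounding the series. *)
Definition sparse (l : 'M[R]_(p, q)) (rho : R) : Prop :=
  forall n, \sum_(i < n | `[< meets (U i) l rho >]) f i <= kap * rho `^ s.

Let kap0 : 0 < kap. Proof. by rewrite invr_gt0 mulr_gt0// exprn_gt0. Qed.

Lemma sum_minr (I : finType) (P : pred I) (g : I -> R) (th : R) :
  (forall i, 0 <= g i) -> 0 <= th -> th <= \sum_(i | P i) g i ->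
  th <= \sum_(i | P i) Num.min (g i) th.
Proof.
move=> g0 th0 H; have [/existsP[i /andP[Pi gi]]|] := boolP [exists i, P i && (th <= g i)].
  rewrite (bigD1 i)//= min_r// lerDl sumr_ge0// => k _.
  by rewrite le_min g0 th0.
rewrite negb_exists => /forallP Hg; apply: (le_trans H).
apply: ler_sum => i Pi; rewrite le_min lexx /=.
by have := Hg i; rewrite Pi /= -ltNge => /ltW.
Qed.

(** Double counting of the pairs formed by a subcube in [S] and a covering set that meets it. If
    every subcube in [S] failed to be sparse, [S] would hold at most a quarter of all subcubes,
    while it holds at least half. *)
Lemma sparse_subcube l rho N (S : pred 'M['I_N]_(p, q)) : 0 < rho -> (0 < N)%N ->
  8 * 5 ^+ d * N%:R `^ s <= N%:R ^+ d -> (N ^ d <= 2 * #|S|)%N ->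
  sparse l rho -> exists2 a, S a & sparse (subcorner l rho a) (rho / N%:R).
Proof.
move=> r0 N0 HN HS sp; apply: contrapT => H.
have N0' : (0 : R) < N%:R by rewrite ltr0n.
set t := rho / N%:R; have t0 : 0 < t by rewrite divr_gt0.
pose m n (a : 'M['I_N]_(p, q)) := [pred i : 'I_n | `[< meets (U i) (subcorner l rho a) t >]].
pose th := kap * t `^ s.
have th0 : 0 < th by rewrite mulr_gt0// powR_gt0.
have H1 (a : 'M['I_N]_(p, q)) : exists n, S a -> th < \sum_(i < n | m n a i) f i.
  have [Sa|nSa] := boolP (S a); last by exists 0%N.
  apply: contrapT => /forallNP Ha; apply: H; exists a => // n.
  by have := Ha n; rewrite not_implyE => -[_ /negP]; rewrite -leNgt.
(* Each failure shows at a finite stage; a common stage [n] for all subcubes keeps the double sum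
   finite. *)
have [nu Hnu] := choice H1; pose n := \max_a nu a.
(* Truncating the weights at [th] does not lower a sum below [th], and it keeps the
   total contribution of a large set, which meets many subcubes, under control. *)
have {}Hnu a : S a -> th <=
    \sum_(i < n) `[< meets (U i) (subcorner l rho a) t >]%:R * Num.min (f i) th.
  move=> /Hnu Ha.
  rewrite (eq_bigr (fun i : 'I_n => if m n a i then Num.min (f i) th else 0)); last first.
    by move=> i _; rewrite /m /=; case: `[< _ >]; rewrite ?mul1r ?mul0r.
  rewrite -big_mkcond /=; apply: sum_minr => //; [by move=> i; exact: ltW|exact: ltW|].
  apply: le_trans (ltW Ha) _.
  have na : (nu a <= n)%N by exact: leq_bigmax.
  rewrite [leRHS]big_mkcond [leLHS]big_mkcond /=.
  rewrite -(big_mkord xpredT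
    (fun i => if `[< meets (U i) (subcorner l rho a) t >] then f i else 0)).
  rewrite -(big_mkord xpredT
    (fun i => if `[< meets (U i) (subcorner l rho a) t >] then f i else 0)).
  rewrite [leRHS](big_cat_nat (n := nu a))//= lerDl sumr_ge0// => i _.
  by case: ifP => // _; exact: ltW.
(* With [b = f i ^ (1/s)] bounding the entrywise diameter, a set with [b <= t] meets at most [5 ^ d]
   subcubes. A larger one meets at most [(5 b / t) ^ d], but its truncated weight is at most
   [th = kap t ^ s], so it contributes [f i * 5 ^ d * kap * (b / t) ^ (d - s)], and [b / t <= N] by
   sparseness of the large cube. *)
have key (i : 'I_n) : Num.min (f i) th *
    #|[pred a : 'M['I_N]_(p, q) | `[< meets (U i) (subcorner l rho a) t >]]|%:R <=
    (if `[< meets (U i) l rho >] then f i else 0) *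
      (5 ^+ d * (1 + kap * (N%:R ^+ d / N%:R `^ s))).
  case: asboolP => [mi|nmi]; last first.
    rewrite (@eq_card0 _ [pred a | _]) ?mulr0 ?mul0r//.
    move=> a; rewrite !inE; apply/asboolP => -[X UX aX]; apply: nmi.
    by exists X => //; exact: subcube_sub r0 aX.
  have fi : f i <= kap * rho `^ s.
    apply: le_trans (sp i.+1); rewrite big_mkcond big_ord_recr /=.
    by rewrite asboolT// lerDr sumr_ge0// => k _; case: ifP => // _; exact: ltW.
  pose b := f i `^ s^-1.
  have b0 : 0 < b by rewrite powR_gt0.
  have bs : b `^ s = f i by rewrite /b -powRrM mulVf ?gt_eqF// powRr1// ltW.
  have Ub X Y : U i X -> U i Y -> forall k j, `|X k j - Y k j| <= b.
    move=> UX UY k j; rewrite -(@powRr1 _ `|_|)// -(@divff _ s) ?gt_eqF//.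
    rewrite powRrM; apply: ge0_ler_powR;
      rewrite ?nnegrE ?powR_ge0 ?invr_ge0 ?(ltW s0) ?(ltW (f0 _))//.
    exact: (Uf UX UY).
  have cm := @card_meets _ _ _ (U i) l rho N b r0 Ub (ltW b0).
  rewrite -/t -/d in cm.
  have min0 : 0 <= Num.min (f i) th by rewrite le_min !ltW.
  apply: le_trans (ler_wpM2l min0 cm) _.
  have [bt|tb] := leP b t.
    apply: (@le_trans _ _ (f i * 5 ^+ d)).
      apply: ler_pM => //; rewrite ?ge_min ?lexx//.
        by rewrite exprn_ge0// addr_ge0// mulr_ge0// divr_ge0// ltW.
      apply: lerXn2r; rewrite ?nnegrE//.
        by rewrite addr_ge0// mulr_ge0// divr_ge0// ltW.
      have : b / t <= 1 by rewrite ler_pdivrMr// mul1r.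
      lra.
    rewrite ler_wpM2l//; first exact: ltW.
    rewrite ler_peMr ?exprn_ge0// lerDl mulr_ge0 ?(ltW kap0)// divr_ge0 ?exprn_ge0 ?powR_ge0//.
  have x1 : 1 <= b / t by rewrite ler_pdivlMr// mul1r ltW.
  have xN : b / t <= N%:R.
    rewrite ler_pdivrMr// /t mulrC divfK ?gt_eqF//.
    have K (x : R) : 0 < x -> x = (x `^ s) `^ s^-1.
      by move=> x0; rewrite -powRrM divff ?gt_eqF// powRr1// ltW.
    rewrite (K b b0) (K rho r0); apply: ge0_ler_powR.
    - by rewrite invr_ge0 ltW.
    - by rewrite nnegrE powR_ge0.
    - by rewrite nnegrE powR_ge0.
    rewrite bs (le_trans fi)// ler_piMl ?powR_ge0// /kap invf_le1 ?mulr_gt0 ?exprn_gt0//.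
    have : (1 : R) <= 5 ^+ d by rewrite exprn_ege1// ler1n.
    lra.
  apply: (@le_trans _ _ (th * (5 * (b / t)) ^+ d)).
    apply: ler_pM => //; rewrite ?ge_min ?lexx ?orbT//.
      by rewrite exprn_ge0// addr_ge0// mulr_ge0// divr_ge0// ltW.
    apply: lerXn2r; rewrite ?nnegrE; [lra|lra|lra].
  rewrite exprMn.
  have -> : (b / t) ^+ d = (f i / t `^ s) * (b / t) `^ (d%:R - s).
    rewrite -bs -[X in _ * X]mulr1 -(@powR_mulrn _ _ d); last lra.
    rewrite -powR_div ?(ltW b0) ?(ltW t0)// mulr1 -powRD; first by rewrite addrC subrK.
    by apply/implyP => _; apply/eqP; lra.
  have -> : th * (5 ^+ d * (f i / t `^ s * (b / t) `^ (d%:R - s))) =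
     f i * (5 ^+ d * (kap * (b / t) `^ (d%:R - s))).
    by rewrite /th; field; rewrite gt_eqF// powR_gt0.
  rewrite ler_wpM2l ?(ltW (f0 _))// ler_wpM2l ?exprn_ge0//.
  rewrite ler_wpDl// ler_wpM2l ?(ltW kap0)//.
  have -> : N%:R ^+ d / N%:R `^ s = N%:R `^ (d%:R - s) :> R.
    rewrite powRB ?powR_mulrn//; apply/implyP => _; exact: lt0r_neq0.
  apply: ge0_ler_powR => //; first by rewrite subr_ge0 ltW.
    by rewrite nnegrE (le_trans _ x1).
  by rewrite nnegrE.
have H2 : #|S|%:R * th <= (5 ^+ d * (1 + kap * (N%:R ^+ d / N%:R `^ s))) * (kap * rho `^ s).
  have -> : #|S|%:R * th = \sum_(a in S) th by rewrite sumr_const mulr_natl.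
  apply: (@le_trans _ _ (\sum_(a : 'M['I_N]_(p, q)) \sum_(i < n)
      `[< meets (U i) (subcorner l rho a) t >]%:R * Num.min (f i) th)).
    rewrite big_mkcond; apply: ler_sum => a _; case: ifP => [/Hnu //|_].
    by apply: sumr_ge0 => i _; rewrite mulr_ge0// le_min !ltW.
  rewrite exchange_big /=.
  rewrite (eq_bigr (fun i : 'I_n => Num.min (f i) th *
    #|[pred a : 'M['I_N]_(p, q) | `[< meets (U i) (subcorner l rho a) t >]]|%:R)); last first.
    by move=> i _; rewrite -mulr_suml mulrC -natr_sum -sum1_card [in RHS]big_mkcond.
  apply: le_trans; first by apply: ler_sum => i _; exact: key.
  rewrite -mulr_suml mulrC ler_wpM2l//.
    by rewrite mulr_ge0 ?exprn_ge0// addr_ge0// mulr_ge0 ?(ltW kap0)//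
      divr_ge0 ?powR_ge0 ?exprn_ge0.
  by rewrite -big_mkcond; exact: sp.
have ts : t `^ s = rho `^ s / N%:R `^ s.
  by rewrite powR_div// ltW.
have Ns0 : (0 : R) < N%:R `^ s by rewrite powR_gt0.
have rs0 : 0 < rho `^ s by rewrite powR_gt0.
(* The value of [kap] turns the contribution of the large sets into [N ^ d / 8]; the choice of [N]
   makes the other term at most as much. *)
have H3 : #|S|%:R <= 5 ^+ d * N%:R `^ s + (8 : R)^-1 * N%:R ^+ d.
  rewrite -(ler_pM2r th0); apply: le_trans H2 _.
  rewrite /th ts /kap le_eqVlt; apply/orP; left; apply/eqP; field.
  by rewrite gt_eqF// expf_neq0.
have H4 : (N%:R : R) ^+ d <= 2 * #|S|%:R by rewrite -natrX -natrM ler_nat.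
have H5 : (0 : R) < N%:R ^+ d by rewrite exprn_gt0.
have : 5 ^+ d * N%:R `^ s <= (8 : R)^-1 * N%:R ^+ d.
  by rewrite -(ler_pM2l (_ : 0 < (8 : R)))// mulrA (le_trans HN)// mulrA divff// mul1r.
lra.
Qed.

(** The limit point of nested sparse cubes lies in no [U i]: otherwise [U i] would meet every cube,
    and sparseness would bound the fixed weight [f i > 0] by quantities tending to 0. *)
Lemma avoid_sets (Good : nat -> set 'M[R]_(p, q)) :
  (forall l rho, 0 < rho -> forall k0, exists2 k, (k0 <= k)%N & exists N0,
     forall N, (N0 <= N)%N ->
     (N ^ d <= 2 * #|[pred a : 'M['I_N]_(p, q) |
        `[< forall X, cube (subcorner l rho a) (rho / N%:R) X -> Good k X >]]|)%N) ->
  (forall n, \sum_(i < n) f i <= (8 * 5 ^+ d)^-1) ->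
  exists2 X, (forall i, ~ U i X) & forall k0, exists2 k, (k0 <= k)%N & Good k X.
Proof.
move=> half sumf.
pose st (x : 'M[R]_(p, q) * R) := 0 < x.2 /\ sparse x.1 x.2.
have step k0 x : exists y, st x -> [/\ st y, forall X, cube y.1 y.2 X -> cube x.1 x.2 X,
    y.2 <= x.2 / 2 & exists2 k, (k0 <= k)%N & forall X, cube y.1 y.2 X -> Good k X].
  have [[r0 sp]|] := pselect (st x); last by move=> nx; exists x => /nx.
  have [k kk0 [N0 HN0]] := half x.1 x.2 r0 k0.
  have ds : 0 < (p * q)%:R - s by rewrite subr_gt0.
  have [N1 HN1] := powR_nat_unbounded (8 * 5 ^+ d) ds.
  (* The three bounds make the side at least halve, the good subcubes at least half, and
     [8 * 5 ^ d * N ^ s <= N ^ d], the last being possible because [s < d]. *)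
  pose N := maxn 2 (maxn N0 N1).
  have N2 : (2 <= N)%N by rewrite leq_max leqnn.
  have Np : (0 : R) < N%:R by rewrite ltr0n (leq_trans _ N2).
  have cN : 8 * 5 ^+ d * N%:R `^ s <= N%:R ^+ d.
    rewrite -[leRHS]powR_mulrn// -(subrK s d%:R) powRD; last first.
      by apply/implyP => _; rewrite gt_eqF.
    by rewrite ler_wpM2r ?powR_ge0// HN1// !leq_max leqnn !orbT.
  have NN0 : (N0 <= N)%N by rewrite !leq_max leqnn !orbT.
  have [a /asboolP aG spa] := sparse_subcube r0 (ltnW N2) cN (HN0 _ NN0) sp.
  exists (subcorner x.1 x.2 a, x.2 / N%:R) => _; split => //=.
  - by split => //=; rewrite divr_gt0.
  - by move=> X; exact: subcube_sub.
  - by rewrite ler_pM2l// lef_pV2 ?posrE// ler_nat.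
  - by exists k.
have [g Hg] := choice (fun k0 => ex_intro _ _ (projT2 (choice (step k0)))).
pose x := fix x k := if k is k'.+1 then g k' (x k') else (0 : 'M[R]_(p, q), 1 : R).
have stx k : st (x k).
  elim: k => [|k IH]; last by have [] := Hg k _ IH.
  (* The starting cube has side 1, so the bound on the total weight is exactly its sparseness. *)
  split => //= n; rewrite powR1 mulr1; apply: le_trans (sumf n).
  rewrite big_mkcond; apply: ler_sum => i _; case: ifP => // _; exact: ltW.
have sub k j : (k <= j)%N -> forall X, cube (x j).1 (x j).2 X -> cube (x k).1 (x k).2 X.
  elim: j => [|j IH]; first by rewrite leqn0 => /eqP ->.
  rewrite leq_eqVlt => /orP[/eqP <- //|kj] X Xj; apply: IH => //.
  have [_ H _ _] := Hg j _ (stx j); exact: H.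
have corner k : cube (x k).1 (x k).2 (x k).1.
  by move=> i j; rewrite lexx lerDl ltW//; have [] := stx k.
have nested i j k l : (x k).1 i j <= (x l).1 i j + (x l).2.
  have [kl|lk] := leqP k l.
    have /andP[h _] := sub _ _ kl _ (corner l) i j; apply: (le_trans h).
    by rewrite lerDl ltW//; have [] := stx l.
  by have /andP[_ h] := sub _ _ (ltnW lk) _ (corner k) i j.
pose X0 i j := xget 0 (fun y => forall k, (x k).1 i j <= y <= (x k).1 i j + (x k).2).
have HX k : cube (x k).1 (x k).2 (\matrix_(i, j) X0 i j).
  move=> i j; rewrite mxE /X0; case: xgetP => [y -> //|].
  by have [y Hy] := nested_intervals (nested i j) => /(_ y).
exists (\matrix_(i, j) X0 i j).
  move=> i UiX.
  have small k : f i <= (x k).2 `^ s.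
    have [rk /(_ i.+1)] := stx k; rewrite big_mkcond big_ord_recr /=.
    rewrite asboolT; last by eexists; [exact: UiX|exact: HX].
    move=> H; apply: le_trans (_ : kap * (x k).2 `^ s <= _).
      by apply: le_trans H; rewrite lerDr sumr_ge0// => j _; case: ifP => // _; exact: ltW.
    rewrite ler_piMl ?powR_ge0// /kap invf_le1 ?mulr_gt0 ?exprn_gt0//.
    have : (1 : R) <= 5 ^+ d by rewrite exprn_ege1// ler1n.
    lra.
  have rate k : k.+1%:R * (x k).2 <= 1.
    elim: k => [|k IH]; first by rewrite mul1r.
    have [_ _ h _] := Hg k _ (stx k); apply: le_trans IH.
    have k2 : (0 : R) <= k.+2%:R by [].
    apply: le_trans (ler_wpM2l k2 h) _; have [r0 _] := stx k.
    have h3 : k.+2%:R <= 2 * k.+1%:R :> R by rewrite -natrM ler_nat; lia.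
    have := ler_wpM2r (ltW r0) h3; lra.
  have [N HN] := powR_nat_unbounded (2 / f i) s0.
  have [r0 _] := stx N.
  have : N.+1%:R `^ s * (x N).2 `^ s <= 1.
    rewrite -powRM ?(ltW r0)// -[leRHS](congr1 (fun h => h s) (powR1 R)).
    apply: ge0_ler_powR => //.
    - exact: ltW.
    - by rewrite nnegrE mulr_ge0// ltW.
    - by rewrite nnegrE.
  have := HN N.+1 (leqnSn _); rewrite ler_pdivrMr// => h1 h2.
  have : N.+1%:R `^ s * f i <= 1 by apply: le_trans h2; rewrite ler_wpM2l ?powR_ge0.
  lra.
move=> k0; have [_ _ _ [k kk0 HG]] := Hg k0 _ (stx k0).
by exists k => //; apply: HG; exact: (HX k0.+1).
Qed.

End avoid.

(** * Lower bounds for the Hausdorff dimension *)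


Section hausdorff_lower.
Context {R : realType}.

Lemma geometric_half_le (n : nat) : \sum_(i < n) (2 : R)^-1 ^+ i.+1 <= 1.
Proof.
suff -> : \sum_(i < n) (2 : R)^-1 ^+ i.+1 = 1 - 2^-1 ^+ n.
  by rewrite gerBl exprn_ge0// invr_ge0.
elim: n => [|n IH]; first by rewrite big_ord0 expr0 subrr.
by rewrite big_ord_recr /= IH exprS; lra.
Qed.

(** Extracts from a null measure the data that the avoidance argument consumes: real, strictly
    positive weights and a strictly positive exponent [s'], even if [s = 0]. *)
Lemma hausdorff_null_covers (V : normedModType R) (A : set V) (s d tau : R) :
  0 <= s -> s < d -> hausdorff_measure s A = 0%E -> 0 < tau ->
  exists2 s' : R, 0 < s' < d & exists U : nat -> set V, exists f : nat -> R,
    [/\ forall x, A x -> exists i, U i x, forall i, 0 < f i,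
        forall n, \sum_(i < n) f i <= tau &
        forall i x y, U i x -> U i y -> `|x - y| `^ s' <= f i].
Proof.
move=> s0 sd Hs t0.
(* One half of [tau] is kept for the slack added to the weights; [1 / 2] is below the weight 1 of a
   nonempty set at exponent 0. *)
pose t := Num.min (tau / 2) (2^-1).
have t_gt0 : 0 < t by rewrite lt_min divr_gt0//= invr_gt0.
have : (hausdorff_premeasure s 1 A < t%:E)%E.
  apply: (@le_lt_trans _ _ 0%E); last by rewrite lte_fin.
  by rewrite -Hs; apply: ereal_sup_ubound; exists 1 => //=.
move=> /ereal_inf_lt[_ [U [AU dU] <-] Ut].
have {}AU x : A x -> exists i, U i x by move=> /AU[i _ Ui]; exists i.
have diam_ge0 i x : U i x -> (0 <= diam (U i))%E.
  move=> Ux; apply: ereal_sup_ubound; exists (x, x) => //=.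
  by rewrite subrr normr0.
have pow_ge0 i : (0 <= diam_pow s (U i))%E.
  by rewrite /diam_pow; case: ifP => // _; exact: poweR_ge0.
have diamP i x y : U i x -> U i y ->
    diam_pow s (U i) = (fine (diam (U i)) `^ s)%:E /\ `|x - y| <= fine (diam (U i)).
  move=> Ux Uy; have d1 := dU i; have d0 := diam_ge0 i x Ux.
  have dfin : diam (U i) \is a fin_num.
    by rewrite ge0_fin_numE// (le_lt_trans d1)// ltry.
  split.
    rewrite /diam_pow ifF; last by apply/negP => /eqP U0; rewrite U0 in Ux.
    by rewrite -{1}(fineK dfin) poweR_EFin.
  rewrite -lee_fin fineK//; apply: ereal_sup_ubound.
  by exists (x, y).
have part n : (\sum_(0 <= i < n) diam_pow s (U i) <= t%:E)%E.
  by apply: le_trans (ltW Ut); apply: nneseries_lim_ge => i _.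
have pow_fin i : diam_pow s (U i) \is a fin_num.
  rewrite ge0_fin_numE//; apply: (@le_lt_trans _ _ t%:E); last by rewrite ltry.
  apply: le_trans (part i.+1); rewrite big_nat_recr//= leeDr//.
  by apply: sume_ge0.
have fpart n : \sum_(i < n) fine (diam_pow s (U i)) <= t.
  rewrite -lee_fin; apply: le_trans (part n).
  rewrite -sumEFin big_mkord; apply: lee_sum => i _.
  by rewrite fineK.
(* The geometric slack makes the weights positive also for empty sets and single points. *)
pose f i := fine (diam_pow s (U i)) + tau / 2 * 2^-1 ^+ i.+1.
have f_gt i : fine (diam_pow s (U i)) < f i.
  by rewrite ltrDl mulr_gt0 ?divr_gt0// exprn_gt0// invr_gt0.
have f0 i : 0 < f i by rewrite (le_lt_trans _ (f_gt i))// fine_ge0.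
have fsum n : \sum_(i < n) f i <= tau.
  rewrite big_split /= -mulr_sumr.
  have h1 : t <= tau / 2 by rewrite ge_min lexx.
  have t2 : 0 <= tau / 2 by rewrite divr_ge0// ltW.
  have := ler_wpM2l t2 (geometric_half_le n); have := fpart n; lra.
have [s0'|s0'] := ltP 0 s.
  exists s; first by rewrite s0' sd.
  exists U, f; split => // i x y Ux Uy.
  have [E xy] := diamP i x y Ux Uy; apply: le_trans (ltW (f_gt i)).
  rewrite E /=; apply: ge0_ler_powR => //; rewrite nnegrE//.
  by rewrite fine_ge0// (diam_ge0 _ x).
(* At exponent 0 a single nonempty set would already exceed the total [t]. So all covering sets are
   empty and any exponent strictly between 0 and [d] serves. *)
have {s0'}s00 : s = 0 by apply/eqP; rewrite eq_le s0 s0'.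
have Ue i x : ~ U i x.
  move=> Ux; have [E _] := diamP i x x Ux Ux.
  have : (1 <= t%:E :> \bar R)%E.
    apply: le_trans (part i.+1); rewrite big_nat_recr//= E s00 powRr0 leeDr//.
    by apply: sume_ge0 => // k _; rewrite -s00.
  by rewrite lee_fin leNgt gt_min [X in _ || X]invf_lt1// ltr1n orbT.
exists (d / 2); first by apply/andP; split; lra.
exists U, f; split => //.
by move=> i x y /Ue.
Qed.

(** A cover of [A] pulls back to a cover of the slice with [W] fixed, without increasing distances
    between entries. A small cover would miss a point [X] that is good infinitely often, yet
    [row_mx X W] is in [A]. *)
Lemma hausdorff_dim_ge (m p q : nat) (W : 'M[R]_(m, q)) (A : set 'M[R]_(m, p + q))
    (Good : nat -> set 'M[R]_(m, p)) :
  (forall l rho, 0 < rho -> forall k0, exists2 k, (k0 <= k)%N & exists N0,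
     forall N, (N0 <= N)%N ->
     (N ^ (m * p) <= 2 * #|[pred a : 'M['I_N]_(m, p) |
        `[< forall X, cube (subcorner l rho a) (rho / N%:R) X -> Good k X >]]|)%N) ->
  (forall X, (forall k0, exists2 k, (k0 <= k)%N & Good k X) -> A (row_mx X W)) ->
  (((m * p)%:R : R)%:E <= hausdorff_dim A)%E.
Proof.
move=> half HA; apply: le_ereal_inf_tmp => _ [s [s0 Hs] <-].
rewrite lee_fin leNgt; apply/negP => sd.
have t0 : (0 : R) < (8 * 5 ^+ (m * p))^-1 by rewrite invr_gt0 mulr_gt0// exprn_gt0.
have [s' /andP[s'0 s'd] [U [f [AU f0 fsum Uf]]]] :=
  hausdorff_null_covers s0 sd Hs t0.
pose U' i : set 'M[R]_(m, p) := fun X => U i (row_mx X W).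
have [|X XU XG] := @avoid_sets _ _ _ s' s'0 s'd U' f f0 _ _ half fsum.
  move=> n X Y UX UY i j; apply: le_trans (Uf n _ _ UX UY).
  apply: ge0_ler_powR; rewrite ?nnegrE//; first exact: ltW.
  have := ler_mx_coord (row_mx X W - row_mx Y W) i (lshift q j).
  by rewrite opp_row_mx add_row_mx row_mxEl !mxE.
by have [i /XU] := AU _ (HA _ XG).
Qed.

End hausdorff_lower.

(** * A criterion for membership in FS *)


Section criterion.
Context {R : realType} {m n : nat}.
Variables (m_gt0 : (0 < m)%N) (n_gt0 : (0 < n)%N).
Variables (N1 : 'cV[R]_n -> R) (N2 : 'cV[R]_m -> R).
Hypothesis N1_norm : is_norm N1.
Variables (Omega : 'M[R]_(m, n)) (c : R).
Variables (b : nat -> 'cV[int]_n) (p : nat -> 'cV[int]_m).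
Let T k := N1 (map_mx intr (b k)).
Let e : R := n%:R / m%:R.
Hypothesis c0 : 0 <= c.
Hypothesis T0 : 1 <= T 0.
Hypothesis TS : forall k, k.+2%:R * T k <= T k.+1.
Hypothesis upper : forall k,
  psi_value N2 Omega (b k, p k) <= c * (1 + k.+1%:R^-1) * T k.+1 `^ (- e).
Hypothesis lower : forall k0, exists2 k, (k0 <= k)%N &
  forall v : 'cV[int]_n * 'cV[int]_m, v.1 != 0 -> N1 (map_mx intr v.1) < T k.+1 ->
    c * (1 - k.+1%:R^-1) * T k.+1 `^ (- e) <= psi_value N2 Omega v.

Let e0 : 0 < e. Proof. by rewrite divr_gt0// ltr0n. Qed.

Let T_ge k : k.+1%:R <= T k.
Proof.
elim: k => [|k IH]; first exact: T0.
apply: le_trans (TS k); rewrite -[leLHS]mulr1 ler_wpM2l//.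
by rewrite (le_trans _ IH)// ler1n.
Qed.

Let T_gt0 k : 0 < T k. Proof. by rewrite (lt_le_trans _ (T_ge k)). Qed.

Let T_mono k j : (k <= j)%N -> T k <= T j.
Proof.
elim: j => [|j IH]; first by rewrite leqn0 => /eqP ->.
rewrite leq_eqVlt => /orP[/eqP <- //|/IH kj]; apply: le_trans kj _.
by apply: le_trans (TS j); rewrite ler_peMl ?ler1n// ltW.
Qed.

Let psi_upper k t : T k <= t ->
  (psi N1 N2 Omega t <= (c * (1 + k.+1%:R^-1) * T k.+1 `^ (- e))%:E)%E.
Proof.
move=> kt; apply: (@le_trans _ _ (psi_value N2 Omega (b k, p k))%:E).
  apply: ereal_inf_lbound; exists (b k, p k) => //; apply/andP; split => //=.
  by apply: le_trans (T_ge k); rewrite ler1n.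
by rewrite lee_fin.
Qed.

Let scaled_upper k t : T k <= t ->
  (scaled_psi N1 N2 Omega t <= (t `^ e * (c * (1 + k.+1%:R^-1) * T k.+1 `^ (- e)))%:E)%E.
Proof.
move=> kt; rewrite /scaled_psi -/e EFinM.
by rewrite lee_wpmul2l ?lee_fin ?powR_ge0// psi_upper.
Qed.

Let powRK k : T k `^ e * T k `^ (- e) = 1.
Proof. by rewrite powRN divff// gt_eqF// powR_gt0. Qed.

(** On [[T k, T k.+1)] the vector [b k] is admissible and [t ^ e] stays below [T k.+1 ^ e], which
    cancels the rate in [upper]. *)
Let Theta_le : (Theta N1 N2 Omega <= c%:E)%E.
Proof.
apply/lee_addgt0Pr => eps eps0; rewrite /Theta limf_esupE.
pose K := Num.truncn (c / eps).
apply: ge_ereal_inf; exists (ereal_sup (scaled_psi N1 N2 Omega @` [set t | T K < t])%classic).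
  exists [set t | T K < t]%classic => //; exists (T K); split => //; exact: num_real.
apply: ge_ereal_sup => _ [t /= Kt <-].
have [k [Kk kt tk]] : exists k, [/\ (K <= k)%N, T k <= t & t < T k.+1].
  have ex : exists j, t < T j.
    exists (Num.truncn t).+1; apply: lt_le_trans (T_ge _).
    by rewrite (lt_le_trans (truncnS_gt _))// ler_nat.
  have := ex_minnP ex; case: ex_minnP => -[|k] tk kmin _.
    by have := lt_trans Kt tk; rewrite ltNge T_mono.
  exists k; split => //.
    by rewrite leqNgt; apply/negP => /T_mono kK; move: (lt_trans Kt tk); rewrite ltNge kK.
  by rewrite leNgt; apply/negP => /kmin; rewrite ltnn.
apply: le_trans (scaled_upper kt) _; rewrite -EFinD lee_fin.
have kK : k.+1%:R^-1 * c <= eps.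
  rewrite mulrC ler_pdivrMr// mulrC -ler_pdivrMr//.
  rewrite (le_trans (ltW (truncnS_gt _)))// ler_nat ltnS; exact: Kk.
rewrite mulrCA; apply: (@le_trans _ _ (c * (1 + k.+1%:R^-1) * 1)); last first.
  by rewrite mulr1 mulrDr mulr1 lerD2l mulrC.
rewrite ler_wpM2l ?mulr_ge0// ?addr_ge0// -(powRK k.+1).
rewrite ler_wpM2r ?powR_ge0//.
apply: ge0_ler_powR; rewrite ?nnegrE ?(ltW e0) ?(ltW tk) ?(ltW (T_gt0 _))//.
by rewrite (le_trans _ kt) ?(ltW (T_gt0 _)).
Qed.

(** The function is sampled just before [T k.+1], at the infinitely many [k] provided by [lower]. *)
Let Theta_ge : (c%:E <= Theta N1 N2 Omega)%E.
Proof.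
rewrite /Theta limf_esupE; apply: le_ereal_inf_tmp => _ [V [M [_ MV]] <-].
apply/lee_subgt0Pr => eps eps0.
have h0 : (0 : R) < 2^-1 `^ e^-1 by rewrite powR_gt0// invr_gt0.
pose K := maxn 1 (maxn (Num.truncn (2 * c / eps)) (Num.truncn (M / 2^-1 `^ e^-1))).
have [k Kk low] := lower K.
have k1 : (1 <= k)%N by rewrite (leq_trans _ Kk)// leq_max leqnn.
set u : R := k.+1%:R^-1; set x : R := 1 - u.
have xh : 2^-1 <= x.
  have : u <= (2 : R)^-1 by rewrite lef_pV2 ?posrE// ler_nat.
  by rewrite /x; lra.
have x1 : x < 1 by rewrite /x ltrBlDr ltrDl invr_gt0.
have x0 : 0 < x by rewrite (lt_le_trans _ xh)// invr_gt0.
(* Strictly below [T k.+1], since [b k.+1] becomes admissible there. The exponent makes [t ^ e] lose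
   exactly the factor [x], so the sampled value is at least [c x ^ 2 >= c - 2 c u]. *)
pose t := T k.+1 * x `^ e^-1.
have ei0 : 0 < e^-1 by rewrite invr_gt0.
have xe1 : x `^ e^-1 < 1.
  have -> : 1 = 1 `^ e^-1 :> R by rewrite powR1.
  by apply: gt0_ltr_powR; rewrite ?in_itv /= ?andbT ?nnegrE ?(ltW x0).
have tT : t < T k.+1 by rewrite /t gtr_pMr.
have Mt : M < t.
  have : 2^-1 `^ e^-1 <= x `^ e^-1.
    by apply: ge0_ler_powR; rewrite ?nnegrE ?(ltW ei0) ?(ltW x0) ?invr_ge0.
  move=> hx; apply: (@lt_le_trans _ _ (T k.+1 * 2^-1 `^ e^-1)); last first.
    by rewrite ler_wpM2l// ltW.
  rewrite -ltr_pdivrMr//; apply: lt_le_trans (T_ge _).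
  rewrite (lt_le_trans (truncnS_gt _))// ler_nat ltnS.
  by apply/leqW/(leq_trans _ Kk); rewrite !leq_max leqnn !orbT.
have te : t `^ e = T k.+1 `^ e * x.
  rewrite /t powRM ?(ltW (T_gt0 _)) ?powR_ge0// -powRrM mulVf ?gt_eqF//.
  by rewrite powRr1// ltW.
apply: (@le_trans _ _ (scaled_psi N1 N2 Omega t)); last first.
  by apply: ereal_sup_ubound; exists t => //; exact: MV.
rewrite /scaled_psi -/e te.
apply: (@le_trans _ _ ((T k.+1 `^ e * x)%:E * (c * x * T k.+1 `^ (- e))%:E)%E).
  rewrite -EFinB -EFinM lee_fin.
  have -> : T k.+1 `^ e * x * (c * x * T k.+1 `^ (- e)) =
    (T k.+1 `^ e * T k.+1 `^ (- e)) * (c * x ^+ 2) by rewrite -/x; ring.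
  rewrite powRK mul1r.
  have : 2 * c * u <= eps.
    rewrite ler_pdivrMr// [leRHS]mulrC -ler_pdivrMr//.
    rewrite (le_trans (ltW (truncnS_gt _)))// ler_nat ltnS.
    by apply/(leq_trans _ Kk); rewrite !leq_max leqnn !orbT.
  have -> : u = 1 - x by rewrite /x; ring.
  have := mulr_ge0 c0 (sqr_ge0 (1 - x)); rewrite !expr2; lra.
rewrite lee_wpmul2l ?lee_fin ?mulr_ge0 ?powR_ge0 ?(ltW x0)//.
apply: le_ereal_inf_tmp => _ [v /andP[v1 vt] <-]; rewrite lee_fin; apply: low.
  apply/eqP => v0; move: v1; rewrite v0 (_ : map_mx _ _ = 0) ?(is_norm0 N1_norm).
    by rewrite ler10.
  by apply/matrixP => i j; rewrite !mxE.
exact: le_lt_trans vt tT.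
Qed.

(** Sampling at [T k] itself, where [b k] has just become admissible, gives at most
    [2 c (k + 2) ^ (- e)], by the growth condition [TS]. *)
Let Theta_low_le : (Theta_low N1 N2 Omega <= 0)%E.
Proof.
rewrite /Theta_low limf_einfE; apply: ge_ereal_sup => _ [V [M [_ MV]] <-].
apply/lee_addgt0Pr => eps eps0; rewrite add0e.
have [N0 HN0] := powR_nat_unbounded (2 * c / eps) e0.
pose k := maxn N0 (Num.truncn M).
have Mk : M < T k.
  apply: lt_le_trans (T_ge k); rewrite (lt_le_trans (truncnS_gt _))// ler_nat ltnS.
  by rewrite leq_max leqnn orbT.
apply: (@le_trans _ _ (scaled_psi N1 N2 Omega (T k))).
  by apply: ereal_inf_lbound; exists (T k) => //; exact: MV.
apply: le_trans (scaled_upper (lexx _)) _; rewrite lee_fin.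
have T2 : T k.+1 `^ (- e) <= (k.+2%:R `^ e)^-1 * T k `^ (- e).
  rewrite !powRN -invfM lef_pV2 ?posrE ?mulr_gt0 ?powR_gt0//.
  rewrite -powRM ?(ltW (T_gt0 _))//.
  apply: ge0_ler_powR; rewrite ?nnegrE ?(ltW e0) ?(ltW (T_gt0 _))//.
  by rewrite mulr_ge0// ltW.
have k1 : k.+1%:R^-1 <= 1 :> R by rewrite invf_le1// ler1n.
apply: (@le_trans _ _ (T k `^ e * (c * (1 + k.+1%:R^-1) * ((k.+2%:R `^ e)^-1 * T k `^ (- e))))).
  by rewrite ler_wpM2l ?powR_ge0// ler_wpM2l// mulr_ge0// addr_ge0.
have -> : T k `^ e * (c * (1 + k.+1%:R^-1) * ((k.+2%:R `^ e)^-1 * T k `^ (- e))) =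
   (T k `^ e * T k `^ (- e)) * (c * (1 + k.+1%:R^-1) / k.+2%:R `^ e) by ring.
rewrite powRK mul1r ler_pdivrMr ?powR_gt0//.
have := HN0 k.+2; rewrite (leq_trans (leq_maxl N0 (Num.truncn M)))//; last by rewrite -/k; lia.
move=> /(_ isT); rewrite ler_pdivrMr// => h.
have := ler_wpM2l c0 k1; move: h; move: (k.+1%:R^-1) (k.+2%:R `^ e) => u P; rewrite mulr1; lra.
Qed.

Lemma FS_criterion : FS N1 N2 c Omega.
Proof.
split; first by apply/eqP; rewrite eq_le Theta_le Theta_ge.
by rewrite /Bad /= ltNge Theta_low_le.
Qed.

End criterion.

(** * Counting matrices with a small value at an integer vector *)


Lemma ltz_norm_S (z : int) (K : nat) : `|z| < K.+1%:Z -> `|z| <= K%:Z.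
Proof. lia. Qed.

Lemma absz_shift (z : int) (K : nat) : `|z| <= K%:Z ->
  (absz (z + K%:Z)%R < (2 * K).+1)%N /\ (absz (z + K%:Z))%:Z - K%:Z = z.
Proof. by move=> ?; split; lia. Qed.

Lemma shift_norm_le (K : nat) (i : 'I_(2 * K).+1) : `|(i : nat)%:Z - K%:Z| <= K%:Z.
Proof. have := ltn_ord i; lia. Qed.

(** The indices are grouped by the integer that they approach. At most [2 (1 + sg N)] integers
    occur, each for at most [4 eta / sg + 1 <= 8 eta / sg] indices; the bounds [eta <= 1 / 4] and
    [sg <= 4 eta] absorb the additive constants. *)
Lemma card_near_int (R : realType) (N : nat) (y sg eta : R) (P : pred 'I_N) :
  0 < sg -> 0 <= eta -> eta <= 4^-1 -> sg <= 4 * eta ->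
  (forall t, P t -> exists z : int, `|y + sg * t%:R + z%:~R| <= eta) ->
  #|P|%:R <= 16 * eta * (N%:R + sg^-1).
Proof.
move=> sg0 eta0 eta4 sge HP.
have /choice[z Hz] : forall t, exists zt : int, P t -> `|y + sg * t%:R + zt%:~R| <= eta.
  by move=> t; have [/HP[zt Hzt]|_] := boolP (P t); [exists zt|exists 0].
have [/pred0P E|/pred0Pn[t0 Pt0]] := boolP (pred0b P).
  by rewrite (eq_card0 E) mulr_ge0 ?mulr_ge0// addr_ge0// invr_ge0 ltW.
pose B := Num.truncn (2 * eta + sg * N%:R).
have Bge : B%:R <= 2 * eta + sg * N%:R.
  by rewrite truncn_le// addr_ge0 ?mulr_ge0// ltW.
have zB t : P t -> `|z t - z t0| <= B%:Z.
  move=> Pt; have h1 := Hz _ Pt; have h2 := Hz _ Pt0.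
  have h3 : `|t%:R - t0%:R : R| <= N%:R.
    have : (t%:R : R) <= N%:R by rewrite ler_nat ltnW.
    have : (t0%:R : R) <= N%:R by rewrite ler_nat ltnW.
    have : (0 : R) <= t%:R by []; have : (0 : R) <= t0%:R by [].
    by rewrite ler_norml => *; apply/andP; split; lra.
  have h4 := ler_wpM2l (ltW sg0) h3.
  have h5 : `|sg * (t%:R - t0%:R) : R| <= sg * N%:R by rewrite normrM gtr0_norm.
  have h6 : `|(z t - z t0)%:~R : R| <= 2 * eta + sg * N%:R.
    move: h1 h2 h5; rewrite intrB !ler_norml => /andP[? ?] /andP[? ?] /andP[? ?].
    by apply/andP; split; lra.
  have : `|z t - z t0|%:~R < (B.+1%:Z)%:~R :> R.
    by rewrite intr_norm; apply: le_lt_trans h6 _; rewrite -pmulrn truncnS_gt.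
  by rewrite ltr_int => /ltz_norm_S.
pose w (t : 'I_N) : 'I_(2 * B).+1 := inord (absz (z t - z t0 + B%:Z)).
have wE t : P t -> (w t : nat)%:Z = z t - z t0 + B%:Z.
  by move=> /zB /absz_shift[h1 h2]; rewrite /w inordK//; apply/eqP; rewrite -subr_eq h2.
have fib (u : 'I_(2 * B).+1) : #|[pred t | P t & w t == u]|%:R <= 4 * eta / sg + 1 :> R.
  have [/pred0P E|/pred0Pn[t1 /andP[/= Pt1 /eqP wt1]]] :=
    boolP (pred0b [pred t | P t & w t == u]).
    by rewrite (eq_card0 E) addr_ge0// divr_ge0 ?mulr_ge0// ltW.
  have B0 : 0 <= 2 * eta / sg by rewrite divr_ge0 ?mulr_ge0// ltW.
  have -> : 4 * eta / sg + 1 = 2 * (2 * eta / sg) + 1 by ring.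
  apply: le_trans (card_ord_near t1 B0); rewrite ler_nat; apply: subset_leq_card.
  apply/fintype.subsetP => t; rewrite !inE => /andP[Pt /eqP wt].
  have zE : z t = z t1.
    by have := wE _ Pt; rewrite wt -wt1 wE// => /addIr/addIr.
  rewrite ler_pdivlMr// -{1}(gtr0_norm sg0) -normrM mulrC.
  have := Hz _ Pt; have := Hz _ Pt1; rewrite zE !ler_norml => /andP[? ?] /andP[? ?].
  by apply/andP; split; lra.
have -> : #|P|%:R = \sum_(u : 'I_(2 * B).+1) #|[pred t | P t & w t == u]|%:R :> R.
  rewrite -natr_sum; congr (_%:R); rewrite -sum1_card (partition_big w xpredT)//=.
  by apply: eq_bigr => u _; rewrite -sum1_card; apply: eq_bigl => t; rewrite !inE.
apply: le_trans (ler_sum _ (fun u _ => fib u)) _.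
rewrite sumr_const card_ord -[leLHS]mulr_natl.
have h1 : 4 * eta / sg + 1 <= 8 * eta / sg.
  have : 1 <= 4 * eta / sg by rewrite ler_pdivlMr// mul1r.
  by lra.
have h2 : (2 * B).+1%:R <= 2 * (1 + sg * N%:R) :> R.
  by rewrite -addn1 natrD natrM; lra.
apply: (@le_trans _ _ (2 * (1 + sg * N%:R) * (8 * eta / sg))).
  by apply: ler_pM => //; rewrite addr_ge0// divr_ge0 ?mulr_ge0// ltW.
by rewrite le_eqVlt; apply/orP; left; apply/eqP; field; rewrite gt_eqF.
Qed.

Section column_update.
Context {N m p : nat}.
Variable h : 'I_p.

Definition set_col (a : 'M['I_N]_(m, p)) (t : 'cV['I_N]_m) : 'M['I_N]_(m, p) :=
  \matrix_(i, j) if j == h then t i 0 else a i j.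

(** Fubini in the column [h]. Swapping this column with an independent one is an involution on
    pairs, so [S] may be counted with the other columns fixed; the rows then give [m] independent
    constraints. *)
Lemma card_by_column (R : realType) (S : pred 'M['I_N]_(m, p)) (B : R) : 0 <= B ->
  (forall a i, exists2 P : pred 'I_N, #|P|%:R <= B & forall t, S (set_col a t) -> P (t i 0)) ->
  #|S|%:R * N%:R ^+ m <= B ^+ m * N%:R ^+ (m * p).
Proof.
move=> B0 HS.
pose phi (x : 'M['I_N]_(m, p) * 'cV['I_N]_m) := (set_col x.1 x.2, col h x.1).
have phiK : involutive phi.
  move=> [a t]; congr (_, _); apply/matrixP => i j; rewrite !mxE /=.
    by case: eqP => [->|].  
  by rewrite eqxx ord1.
have E : (\sum_(x : 'M['I_N]_(m, p) * 'cV['I_N]_m) (S (set_col x.1 x.2)) = #|S| * N ^ m)%N.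
  rewrite (reindex_inj (inv_inj phiK)) /=.
  rewrite (eq_bigr (fun x : 'M['I_N]_(m, p) * 'cV['I_N]_m => S x.1 : nat)); last first.
    by move=> x _; have := phiK x; case: x => a t [-> _].
  rewrite -(pair_bigA _ (fun a (t : 'cV['I_N]_m) => S a : nat)) /=.
  under eq_bigr do rewrite sum_nat_const card_mx card_ord muln1.
  by rewrite -big_distrr /= mulnC -sum1_card [in RHS]big_mkcond.
rewrite -natrX -natrM -E natr_sum.
rewrite -(pair_bigA _ (fun a (t : 'cV['I_N]_m) => (S (set_col a t))%:R)) /=.
apply: (@le_trans _ _ (\sum_(a : 'M['I_N]_(m, p)) B ^+ m)).
  apply: ler_sum => a _.
  have [P HP1 HP2] : exists2 P : 'I_m -> pred 'I_N, (forall i, #|P i|%:R <= B) &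
      forall i t, S (set_col a t) -> P i (t i 0).
    have /choice[P HP] : forall i, exists P : pred 'I_N, #|P|%:R <= B /\
        forall t, S (set_col a t) -> P (t i 0).
      by move=> i; have [P ? ?] := HS a i; exists P.
    by exists P => i; have [] := HP i.
  rewrite -natr_sum.
  apply: (@le_trans _ _ (\prod_(i < m) \prod_(j < 1) #|P i|)%:R).
    rewrite ler_nat; apply: leq_trans (card_mx_entries (fun i _ => P i)).
    rewrite -sum1_card [leqRHS]big_mkcond /=; apply: leq_sum => t _.
    rewrite inE; case: (boolP (S _)) => //= St; rewrite ifT//.
    by apply/forallP => i; apply/forallP => j; rewrite (ord1 j); exact: HP2.
  under eq_bigr do rewrite big_ord1.
  rewrite natr_prod -[leRHS](_ : \prod_(i < m) B = _); last by rewrite prodr_const card_ord.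
  by apply: ler_prod => i _; rewrite ler0n HP1.
by rewrite sumr_const card_mx card_ord -natrX mulr_natr.
Qed.

End column_update.

Lemma card_near_int_neq0 (R : realType) (N : nat) (y sg eta : R) (P : pred 'I_N) :
  sg != 0 -> 0 <= eta -> eta <= 4^-1 -> `|sg| <= 4 * eta ->
  (forall t, P t -> exists z : int, `|y + sg * t%:R + z%:~R| <= eta) ->
  #|P|%:R <= 16 * eta * (N%:R + `|sg|^-1).
Proof.
move=> sg0 eta0 eta4; have [sgp|sgn|/eqP] := ltgtP 0 sg; last by rewrite eq_sym (negbTE sg0).
  by rewrite gtr0_norm// => *; apply: (@card_near_int _ _ y).
rewrite ltr0_norm// => sge HP; apply: (@card_near_int _ _ (- y)) => //.
  by rewrite oppr_gt0.
move=> t /HP[z Hz]; exists (- z); rewrite intrN mulNr -!opprD normrN.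
by rewrite [X in `|X|]addrC addrC.
Qed.

(** When only the column [h] varies, each row of the value runs along an arithmetic progression of
    step [rho / N * x h]. The term [(rho |x h|)^-1] is the loss when this progression does not cover
    a full period. *)
Lemma card_near_lattice (R : realType) m p N (l : 'M[R]_(m, p)) (rho eta : R)
    (x : 'cV[int]_p) (h : 'I_p) (v : 'cV[R]_m) :
  0 < rho -> (0 < N)%N -> 0 < eta -> eta <= 4^-1 -> x h 0 != 0 ->
  rho * `|(x h 0)%:~R| <= 4 * eta * N%:R ->
  #|[pred a : 'M['I_N]_(m, p) | `[< exists y : 'cV[int]_m, forall i,
      `|(subcorner l rho a *m map_mx intr x + v + map_mx intr y) i 0| <= eta >]]|%:R <=
  (16 * eta * (1 + (rho * `|(x h 0)%:~R|)^-1)) ^+ m * N%:R ^+ (m * p) :> R.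
Proof.
move=> r0 N0 eta0 eta4 xh HN.
have N0' : (0 : R) < N%:R by rewrite ltr0n.
have xh0 : ((x h 0)%:~R : R) != 0 by rewrite intr_eq0.
pose sg : R := rho / N%:R * (x h 0)%:~R.
have sg0 : sg != 0 by rewrite mulf_neq0// gt_eqF// divr_gt0.
have sgE : `|sg| = rho * `|(x h 0)%:~R| / N%:R.
  by rewrite /sg normrM gtr0_norm ?divr_gt0// mulrAC.
set S := [pred a | _].
have B0 : 0 <= 16 * eta * (N%:R + `|sg|^-1).
  by rewrite mulr_ge0 ?mulr_ge0 ?(ltW eta0)// addr_ge0// invr_ge0.
have Nm0 : (0 : R) < N%:R ^+ m by rewrite exprn_gt0.
rewrite -(ler_pM2r Nm0) mulrAC.
rewrite [X in _ <= X * _ ^+ (m * p)](_ : _ =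
    (16 * eta * (N%:R + `|sg|^-1)) ^+ m); last first.
  rewrite -exprMn; congr (_ ^+ m); rewrite sgE; field.
  by rewrite !gt_eqF//= normr_gt0.
apply: (@card_by_column _ _ _ h) => // a i.
pose y0 := \sum_(j | j != h) subcorner l rho a i j * (x j 0)%:~R + l i h * (x h 0)%:~R + v i 0.
exists [pred t : 'I_N | `[< exists z : int, `|y0 + sg * t%:R + z%:~R| <= eta >]].
  apply: (@card_near_int_neq0 _ _ y0) => //; first exact: ltW.
  - by rewrite sgE ler_pdivrMr.
  - by move=> t; rewrite inE => /asboolP.
move=> t; rewrite /S inE => /asboolP[y Hy]; rewrite inE; apply/asboolP; exists (y i 0).
have := Hy i; rewrite !mxE (bigD1 h)//= !mxE eqxx.
suff -> : \sum_(j | j != h) subcorner l rho (set_col h a t) i j * (map_mx intr x : 'cV[R]_p) j 0 =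
    \sum_(j | j != h) subcorner l rho a i j * (x j 0)%:~R.
  by rewrite /y0 /sg; congr (`| _ | <= _); ring.
by apply: eq_bigr => j jh; rewrite !mxE (negbTE jh).
Qed.

Section avoiding.
Context {R : realType} {m p q : nat}.
Variables (N1 : 'cV[R]_(p + q) -> R) (N2 : 'cV[R]_m -> R).
Hypothesis (N1_norm : is_norm N1) (N2_norm : is_norm N2).

Definition avoids (W : 'M[R]_(m, q)) (T delta : R) (X : 'M[R]_(m, p)) : Prop :=
  forall (x : 'cV[int]_p) (j : 'cV[int]_q) (y : 'cV[int]_m), x != 0 ->
    N1 (map_mx intr (col_mx x j)) < T ->
    delta <= N2 (X *m map_mx intr x + W *m map_mx intr j + map_mx intr y).

(** A union bound over the integer vectors with entries at most [K], split by whether some entry of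
    the [X]-part exceeds [1 / rho]. If so, the values cover a full period and the proportion is at
    most [(32 eta) ^ m]. The others have a worse proportion, but their number grows only like
    [K ^ q]. *)
Lemma card_not_avoiding (W : 'M[R]_(m, q)) (l : 'M[R]_(m, p)) (rho C1 C2 T delta eta : R)
    (K N : nat) :
  0 < rho -> (0 < N)%N ->
  (forall (v : 'cV[R]_(p + q)) i, `|v i 0| <= C1 * N1 v) ->
  (forall (v : 'cV[R]_m) i, `|v i 0| <= C2 * N2 v) ->
  0 < C1 -> 0 < C2 -> C1 * T < K.+1%:R -> 0 < eta -> eta <= 4^-1 ->
  2 * (C2 * delta) <= eta -> rho * (p * K)%:R / N%:R <= eta / 2 ->
  #|[pred a : 'M['I_N]_(m, p) | ~~ `[< forall X, cube (subcorner l rho a) (rho / N%:R) X ->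
       avoids W T delta X >]]|%:R <=
  (((2 * K).+1%:R ^+ (p + q)) * (32 * eta) ^+ m +
   (2 / rho + 1) ^+ p * (2 * K).+1%:R ^+ q * (16 * eta * (1 + rho^-1)) ^+ m) *
   N%:R ^+ (m * p) :> R.
Proof.
move=> r0 N0 HC1 HC2 C10 C20 TK eta0 eta4 deta HN.
have N0' : (0 : R) < N%:R by rewrite ltr0n.
pose dec (u : 'cV['I_(2 * K).+1]_(p + q)) : 'cV[int]_(p + q) :=
  map_mx (fun i : 'I_(2 * K).+1 => (i : nat)%:Z - K%:Z) u.
pose near (u : 'cV['I_(2 * K).+1]_(p + q)) :=
  [pred a : 'M['I_N]_(m, p) | `[< exists y : 'cV[int]_m, forall i,
    `|(subcorner l rho a *m map_mx intr (usubmx (dec u)) +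
       W *m map_mx intr (dsubmx (dec u)) + map_mx intr y) i 0| <= eta >]].
set bad := [pred a | _].
have cover a : bad a -> exists2 u, usubmx (dec u) != 0 & near u a.
  rewrite /bad /= => /asboolPn/existsNP[X]; rewrite not_implyE => -[aX].
  move=> /existsNP[x /existsNP[j /existsNP[y]]].
  rewrite !not_implyE => -[x0 [xT /negP]].
  rewrite -ltNge => Hd.
  have small i : `|col_mx x j i 0| <= K%:Z.
    have := le_lt_trans (HC1 _ i) (le_lt_trans (ler_wpM2l (ltW C10) (ltW xT)) TK).
    rewrite mxE -intr_norm; have -> : K.+1%:R = (K.+1%:Z)%:~R :> R by [].
    by rewrite ltr_int => /ltz_norm_S.
  pose u : 'cV['I_(2 * K).+1]_(p + q) :=
    map_mx (fun z : int => inord (absz (z + K%:Z))) (col_mx x j).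
  have uE : dec u = col_mx x j.
    apply/colP => i; rewrite [LHS]mxE [u i 0]mxE.
    by have [h1 h2] := absz_shift (small i); rewrite inordK.
  exists u; first by rewrite uE col_mxKu.
  rewrite /near /=; apply/asboolP; exists y => i; rewrite uE col_mxKu col_mxKd.
  set A := subcorner l rho a.
  (* A bad subcube is detected at its corner: half of [eta] bounds the value at [X], the other half
     the change from [X] to the corner. *)
  have -> : A *m map_mx intr x + W *m map_mx intr j + map_mx intr y =
    (X *m map_mx intr x + W *m map_mx intr j + map_mx intr y) - (X - A) *m map_mx intr x.
    by rewrite mulmxBl opprB [RHS]addrC -!addrA; congr (_ + _); rewrite addKr.
  rewrite mxE; apply: le_trans (ler_normD _ _) _.
  have h1 : `|(X *m map_mx intr x + W *m map_mx intr j + map_mx intr y) i 0| <= eta / 2.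
    apply: le_trans (HC2 _ i) _; apply: le_trans (ler_wpM2l (ltW C20) (ltW Hd)) _; lra.
  suff h2 : `|(- ((X - A) *m map_mx intr x : 'cV[R]_m)) i 0| <= eta / 2 by lra.
  apply: le_trans HN; rewrite mxE normrN mxE.
  apply: le_trans (ler_norm_sum _ _ _) _.
  have -> : rho * (p * K)%:R / N%:R = \sum_(k < p) (rho / N%:R * K%:R).
    by rewrite sumr_const card_ord -mulr_natl natrM; ring.
  apply: ler_sum => k _; rewrite normrM; apply: ler_pM => //.
    rewrite !mxE; have /andP := aX i k; rewrite -/A !mxE => -[h3 h4].
    by rewrite ger0_norm; lra.
  have := small (lshift q k); rewrite col_mxEu !mxE -intr_norm.
  by have -> : K%:R = (K%:Z)%:~R :> R by []; rewrite ler_int.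
pose smallset := [pred u : 'cV['I_(2 * K).+1]_(p + q) |
  [forall k, `|(usubmx (dec u) k 0)%:~R| <= rho^-1 :> R]].
have Kmid : (K < (2 * K).+1)%N by rewrite ltnS mul2n -addnn leq_addr.
have csmall : #|smallset|%:R <= (2 / rho + 1) ^+ p * (2 * K).+1%:R ^+ q :> R.
  pose P (i : 'I_(p + q)) (_ : 'I_1) : pred 'I_(2 * K).+1 :=
    if fintype.split i
    then [pred t : 'I_(2 * K).+1 | `|t%:R - (Ordinal Kmid : nat)%:R : R| <= rho^-1]
    else predT.
  apply: (@le_trans _ _ (\prod_(i < p + q) \prod_(j < 1) #|P i j|)%:R).
    rewrite ler_nat; apply: leq_trans (card_mx_entries P); apply: subset_leq_card.
    apply/fintype.subsetP => u; rewrite inE => /forallP Hu.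
    apply/forallP => i; apply/forallP => j; rewrite (ord1 j) /P.
    case: fintype.splitP => [k ik|//] /=.
    have := Hu k; rewrite !mxE (_ : lshift q k = i); last by apply: val_inj.
    by rewrite intrB.
  under eq_bigr do rewrite big_ord1.
  rewrite big_split_ord /= natrM; apply: ler_pM => //.
    rewrite natr_prod -[leRHS](_ : \prod_(i < p) (2 / rho + 1) = _).
      apply: ler_prod => i _; rewrite ler0n /= /P (unsplitK (inl i)).
      by apply: card_ord_near; rewrite invr_ge0 ltW.
    by rewrite prodr_const card_ord.
  rewrite natr_prod -[leRHS](_ : \prod_(i < q) (2 * K).+1%:R = _).
    apply: ler_prod => i _; rewrite ler0n /= /P (unsplitK (inr i)).
    by rewrite ler_nat cardT size_enum_ord.
  by rewrite prodr_const card_ord.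
have rV0 : 0 < rho^-1 by rewrite invr_gt0.
have ge32 : 0 <= (32 * eta) ^+ m by rewrite exprn_ge0// mulr_ge0// ltW.
have ge16 : 0 <= (16 * eta * (1 + rho^-1)) ^+ m.
  by rewrite exprn_ge0// mulr_ge0 ?mulr_ge0 ?addr_ge0// ltW.
have per u : usubmx (dec u) != 0 -> #|near u|%:R <=
    ((32 * eta) ^+ m + (smallset u)%:R * (16 * eta * (1 + rho^-1)) ^+ m) * N%:R ^+ (m * p).
  move=> u0.
  have Kle k : `|(usubmx (dec u) k 0)%:~R| <= K%:R :> R.
    rewrite -intr_norm; have -> : K%:R = (K%:Z)%:~R :> R by [].
    by rewrite ler_int !mxE shift_norm_le.
  have main h : usubmx (dec u) h 0 != 0 -> #|near u|%:R <=
      (16 * eta * (1 + (rho * `|(usubmx (dec u) h 0)%:~R|)^-1)) ^+ m * N%:R ^+ (m * p).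
    move=> uh; apply: card_near_lattice => //.
    have p0 : (0 < p)%N by apply: leq_ltn_trans (ltn_ord h).
    have : rho * K%:R <= rho * (p * K)%:R by rewrite ler_wpM2l ?(ltW r0)// ler_nat leq_pmull.
    move: HN; rewrite ler_pdivrMr// => h1 h2.
    have := ler_wpM2l (ltW r0) (Kle h); have := mulr_gt0 eta0 N0'; lra.
  have [us|] := boolP (smallset u).
    have [h uh] : exists h, usubmx (dec u) h 0 != 0.
      apply: contrapT => /forallNP H; move/eqP: u0; apply; apply/colP => h.
      rewrite [RHS]mxE; apply/eqP; rewrite -[_ == _]negbK; apply/negP; exact: H.
    apply: le_trans (main _ uh) _; rewrite ler_wpM2r ?exprn_ge0// mul1r.
    apply: ler_wpDl => //; apply: lerXn2r; rewrite ?nnegrE.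
    - by rewrite mulr_ge0 ?mulr_ge0 ?addr_ge0 ?invr_ge0 ?mulr_ge0// ltW.
    - by rewrite mulr_ge0 ?mulr_ge0 ?addr_ge0// ltW.
    rewrite ler_wpM2l ?mulr_ge0 ?(ltW eta0)// lerD2l.
    have u1 : 1 <= `|(usubmx (dec u) h 0)%:~R| :> R.
      by rewrite -intr_norm (_ : 1 = (1 : int)%:~R)// ler_int -gtz0_ge1 normr_gt0.
    rewrite lef_pV2 ?posrE// ?mulr_gt0//; last by rewrite (lt_le_trans _ u1).
    by rewrite ler_peMr// ltW.
  rewrite /smallset /= negb_forall => /existsP[h]; rewrite -ltNge => uh.
  have uh0 : usubmx (dec u) h 0 != 0.
    by apply/eqP => E; move: uh; rewrite E normr0 ltNge ltW.
  apply: le_trans (main _ uh0) _; rewrite ler_wpM2r ?exprn_ge0//.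
  rewrite (le_trans (_ : _ <= (32 * eta) ^+ m))//; last first.
    by rewrite lerDl mulr_ge0.
  apply: lerXn2r; rewrite ?nnegrE.
  - by rewrite mulr_ge0 ?mulr_ge0 ?addr_ge0 ?invr_ge0 ?mulr_ge0// ltW.
  - by rewrite mulr_ge0// ltW.
  have : (rho * `|(usubmx (dec u) h 0)%:~R|)^-1 <= 1.
    by rewrite invf_le1 ?mulr_gt0 ?(lt_trans _ uh)// -ler_pdivrMl// mulr1 ltW.
  by nra.
apply: (@le_trans _ _ (\sum_(u | usubmx (dec u) != 0) #|near u|%:R)).
  rewrite -natr_sum ler_nat.
  rewrite -sum1_card (eq_bigr (fun u => \sum_(a | near u a) 1)%N); last first.
    by move=> u _; rewrite -sum1_card.
  rewrite (exchange_big_dep xpredT)//= [leqLHS]big_mkcond /=.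
  apply: leq_sum => a _; case: ifP => // /cover[u u0 ua].
  by rewrite (bigD1 u)//= u0.
apply: le_trans (ler_sum _ per) _.
apply: (@le_trans _ _ (\sum_u ((32 * eta) ^+ m + (smallset u)%:R *
    (16 * eta * (1 + rho^-1)) ^+ m) * N%:R ^+ (m * p))).
  rewrite [leLHS]big_mkcond; apply: ler_sum => u _; case: ifP => // _.
  by rewrite mulr_ge0 ?exprn_ge0// addr_ge0// mulr_ge0.
rewrite -mulr_suml ler_wpM2r ?exprn_ge0// big_split /= sumr_const card_mx card_ord muln1.
rewrite -[_ *+ (_ ^ _)]mulr_natl natrX lerD2l -mulr_suml ler_wpM2r//.
by apply: le_trans csmall; rewrite -natr_sum ler_nat -sum1_card [leqRHS]big_mkcond.
Qed.

End avoiding.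


Lemma powR_rate (R : realType) (m n : nat) (T : R) : (0 < m)%N -> 0 <= T ->
  (T `^ (- (n%:R / m%:R))) ^+ m = T ^- n.
Proof.
move=> m0 T0; rewrite -powR_mulrn ?powR_ge0// -powRrM mulNr divfK.
  by rewrite powR_invn.
by rewrite pnatr_eq0 -lt0n.
Qed.

Lemma half_avoiding (R : realType) (m p q : nat)
    (N1 : 'cV[R]_(p + q) -> R) (N2 : 'cV[R]_m -> R) :
  (0 < m)%N -> (0 < p)%N -> is_norm N1 -> is_norm N2 ->
  exists2 c0 : R, 0 < c0 & forall c, 0 < c <= c0 ->
  forall (W : 'M[R]_(m, q)) (l : 'M[R]_(m, p)) (rho : R), 0 < rho ->
  exists T0, forall T, T0 <= T -> exists N0, forall N, (N0 <= N)%N ->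
    (N ^ (m * p) <= 2 * #|[pred a : 'M['I_N]_(m, p) |
      `[< forall X, cube (subcorner l rho a) (rho / N%:R) X ->
            avoids N1 N2 W T (c * T `^ (- ((p + q)%:R / m%:R))) X >]]|)%N.
Proof.
move=> m0 p0 nN1 nN2.
have [C1 C10 HC1'] := entries_le_norm nN1; have [C2 C20 HC2] := entries_le_norm nN2.
pose C := 1 + C1; have C1_ge : 1 <= C by rewrite lerDl ltW.
have C0 : 0 < C by rewrite (lt_le_trans _ C1_ge).
have HC1 (v : 'cV[R]_(p + q)) i : `|v i 0| <= C * N1 v.
  by apply: le_trans (HC1' v i) _; rewrite ler_wpM2r ?(is_norm_ge0 nN1)// lerDr.
set n := (p + q)%N; set e : R := n%:R / m%:R.
pose A := (3 * C) ^+ n.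
have A1 : 1 <= A by rewrite exprn_ege1//; lra.
have A0 : 0 < A by rewrite (lt_le_trans _ A1).
(* About [A T ^ n] vectors, each bad on a proportion [(64 C2 c) ^ m T ^ (- n)], must add up to at
   most [1 / 4]. This [c0] does not depend on [W], [l] or [rho]. *)
exists ((4 * A)^-1 / (64 * C2)); first by rewrite divr_gt0 ?invr_gt0 ?mulr_gt0.
move=> c /andP[c0 cc0] W l rho r0.
have cA : 64 * C2 * c <= (4 * A)^-1.
  by move: cc0; rewrite ler_pdivlMr ?mulr_gt0// mulrC.
have rV0 : 0 < rho^-1 by rewrite invr_gt0.
pose Kr := (2 / rho + 1) ^+ p * (3 * C) ^+ q * (32 * C2 * c * (1 + rho^-1)) ^+ m.
(* The vectors with small [X]-part contribute [Kr / T ^ p], which depends on [rho] through [Kr] but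
   falls below [1 / 4] for large [T] because [p > 0]. *)
exists (Num.max 1 (4 * Kr)) => T; rewrite ge_max => /andP[T1 TK].
have T0 : 0 < T by rewrite (lt_le_trans _ T1).
set delta := c * T `^ (- e).
have P0 : 0 < T `^ (- e) by rewrite powR_gt0.
have delta0 : 0 < delta by rewrite mulr_gt0.
pose eta := 2 * (C2 * delta).
have eta0 : 0 < eta by rewrite !mulr_gt0.
pose K := Num.truncn (C * T).
have KT : K%:R <= C * T by rewrite truncn_le mulr_ge0 ?(ltW C0) ?(ltW T0).
exists (Num.truncn (rho * (p * K)%:R * 2 / eta)).+1 => N HN.
have N0 : (0 < N)%N by apply: leq_ltn_trans HN.
have N0' : (0 : R) < N%:R by rewrite ltr0n.
have P1 : T `^ (- e) <= 1.
  rewrite powRN invf_le1 ?powR_gt0// -[leLHS](powRr0 T) ler_powR//.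
  by rewrite divr_ge0.
have eta4 : eta <= 4^-1.
  have h1 : C2 * delta <= C2 * c.
    by rewrite ler_wpM2l ?(ltW C20)// /delta ler_piMr// ltW.
  have h2 : (4 * A)^-1 <= 4^-1 by rewrite lef_pV2 ?posrE ?mulr_gt0//; lra.
  have := mulr_gt0 C20 c0; rewrite /eta; lra.
have HN' : rho * (p * K)%:R / N%:R <= eta / 2.
  have : rho * (p * K)%:R * 2 / eta <= N%:R.
    by rewrite (le_trans (ltW (truncnS_gt _)))// ler_nat.
  rewrite ler_pdivrMr// => h.
  by rewrite ler_pdivrMr//; move: h; set z := N%:R; set w := rho * _; lra.
have := @card_not_avoiding R m p q N1 N2 W l rho C C2 T delta eta K N r0 N0 HC1 HC2 C0 C20
  (truncnS_gt _) eta0 eta4 (lexx _) HN'.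
set bad := [pred a | _]; set good := [pred a | _] => Hbad.
have cgb : (#|bad| + #|good| = N ^ (m * p))%N.
  rewrite -[N in RHS]card_ord -card_mx -(cardC bad); congr (_ + _)%N.
  by apply: eq_card => a; rewrite !inE negbK.
have D3 : (2 * K).+1%:R <= 3 * C * T.
  have := ler_pM ler01 ler01 C1_ge T1; rewrite -addn1 natrD natrM mulr1; lra.
have D0 : (0 : R) <= (2 * K).+1%:R by [].
have CT0 : 0 < 3 * C * T by rewrite !mulr_gt0.
have Tm : (T `^ (- e)) ^+ m = T ^- n by rewrite powR_rate ?ltW.
have Tn0 : 0 < T ^+ n by rewrite exprn_gt0.
have B1 : (2 * K).+1%:R ^+ n * (32 * eta) ^+ m <= 4^-1.
  apply: (@le_trans _ _ ((3 * C * T) ^+ n * (32 * eta) ^+ m)).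
    apply: ler_wpM2r; first by rewrite exprn_ge0// mulr_ge0// ltW.
    by apply: lerXn2r; rewrite ?nnegrE// ltW.
  have -> : 32 * eta = (64 * C2 * c) * T `^ (- e) by rewrite /eta /delta; ring.
  rewrite [(_ * T `^ _) ^+ m]exprMn [(3 * C * T) ^+ n]exprMn Tm -/A.
  have -> : A * T ^+ n * ((64 * C2 * c) ^+ m * T ^- n) = A * (64 * C2 * c) ^+ m.
    by field; rewrite gt_eqF.
  have x0 : 0 <= 64 * C2 * c by rewrite !mulr_ge0 ?ltW.
  have x1 : 64 * C2 * c <= 1.
    by apply: le_trans cA _; rewrite invf_le1 ?mulr_gt0//; lra.
  apply: (@le_trans _ _ (A * (64 * C2 * c))).
    rewrite ler_wpM2l ?(ltW A0)// -{2}[64 * C2 * c]expr1.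
    by apply: ler_wiXn2l.
  apply: le_trans (ler_wpM2l (ltW A0) cA) _.
  by rewrite invfM mulrCA divff ?mulr1// gt_eqF.
have B2 : (2 / rho + 1) ^+ p * (2 * K).+1%:R ^+ q * (16 * eta * (1 + rho^-1)) ^+ m <= 4^-1.
  have g0 : 0 <= 2 / rho + 1 by rewrite addr_ge0// mulr_ge0// ltW.
  have -> : 16 * eta * (1 + rho^-1) = (32 * C2 * c * (1 + rho^-1)) * T `^ (- e).
    by rewrite /eta /delta; ring.
  have y0 : 0 <= (32 * C2 * c * (1 + rho^-1)) ^+ m.
    by rewrite exprn_ge0// !mulr_ge0 ?addr_ge0 ?(ltW C20) ?(ltW c0) ?(ltW rV0).
  rewrite [(_ * T `^ _) ^+ m]exprMn Tm.
  apply: (@le_trans _ _ ((2 / rho + 1) ^+ p * (3 * C * T) ^+ q *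
      ((32 * C2 * c * (1 + rho^-1)) ^+ m * T ^- n))).
    apply: ler_wpM2r; first by rewrite mulr_ge0// invr_ge0 ltW.
    apply: ler_wpM2l; first by rewrite exprn_ge0.
    by apply: lerXn2r; rewrite ?nnegrE// ltW.
  have -> : (2 / rho + 1) ^+ p * (3 * C * T) ^+ q *
      ((32 * C2 * c * (1 + rho^-1)) ^+ m * T ^- n) = Kr / T ^+ p.
    rewrite /Kr /n exprD [(3 * C * T) ^+ q]exprMn; field.
    by rewrite !expf_neq0 ?gt_eqF.
  rewrite ler_pdivrMr ?exprn_gt0//.
  have : T <= T ^+ p by rewrite -{1}[T]expr1 ler_weXn2l.
  lra.
rewrite -(ler_nat R) -cgb natrD natrM.
have NN0 : (0 : R) < N%:R ^+ (m * p) by rewrite exprn_gt0.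
have : #|bad|%:R <= 2^-1 * N%:R ^+ (m * p) :> R.
  apply: le_trans Hbad _; apply: ler_wpM2r; first exact: ltW.
  by lra.
rewrite -natrX -cgb natrD; lra.
Qed.

(** * Limits of matrices with successive extremal relations *)


Section iteration.
Context {R : realType} {m q : nat}.
Variables (M : 'cV[R]_q -> R) (N2 : 'cV[R]_m -> R).
Hypothesis (M_norm : is_norm M) (N2_norm : is_norm N2).
Variables (c e : R).
Hypothesis c0 : 0 < c.

(* Just below [t = M b'], the function [t ^ e * psi t] of [W] is within a factor
   [1 +- eps] of [c], and [b] is nearly minimal there. *)
Definition psi_peak (eps : R) (W : 'M[R]_(m, q)) (b b' : 'cV[int]_q) : Prop :=
  (exists y : 'cV[int]_m, N2 (W *m map_mx intr b + map_mx intr y) <=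
     c * (1 + eps) * M (map_mx intr b') `^ (- e)) /\
  (forall (j : 'cV[int]_q) (y : 'cV[int]_m), j != 0 ->
     M (map_mx intr j) < M (map_mx intr b') ->
     c * (1 - eps) * M (map_mx intr b') `^ (- e) <=
     N2 (W *m map_mx intr j + map_mx intr y)).

(** Only [b] and vectors [j] shorter than [b'] are tested, so their entries are bounded by [B]. The
    vector [y] ranges over infinitely many values but cancels in the difference, hence one radius
    serves them all. *)
Lemma psi_peak_open W b b' eps : 0 < eps -> 0 < M (map_mx intr b') ->
  psi_peak eps W b b' -> exists2 r : R, 0 < r &
    forall W' : 'M[R]_(m, q), (forall i j, `|W' i j - W i j| <= r) ->
      psi_peak (2 * eps) W' b b'.
Proof.
move=> eps0 Mb' [[y Hy] low].
have [C1 C10 HC1] := entries_le_norm M_norm.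
have [C2 C20 HC2] := norm_le_entries N2_norm.
set T := M (map_mx intr b') in Mb' Hy low *.
pose B := C1 * (M (map_mx intr b) + T).
have B0 : 0 < B by rewrite mulr_gt0// ltr_wpDl// (is_norm_ge0 M_norm).
have P0 : 0 < c * eps * T `^ (- e) by rewrite !mulr_gt0// powR_gt0.
(* [q.+1] in place of [q] keeps [D] positive also for [q = 0]. *)
pose D := C2 * (q.+1%:R * B).
have D0 : 0 < D by rewrite mulr_gt0// mulr_gt0.
pose r := c * eps * T `^ (- e) / D.
have r0 : 0 < r by exact: divr_gt0.
exists r => // W' HW'.
have pert (V V' : 'M[R]_(m, q)) (j : 'cV[int]_q) (z : 'cV[int]_m) :
    (forall i k, `|V i k - V' i k| <= r) ->
    (forall k, `|(j k 0)%:~R| <= B) ->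
    N2 (V *m map_mx intr j + map_mx intr z) <=
    N2 (V' *m map_mx intr j + map_mx intr z) + c * eps * T `^ (- e).
  move=> HV Hj.
  have -> : V *m map_mx intr j + map_mx intr z =
     (V' *m map_mx intr j + map_mx intr z) + (V - V') *m map_mx intr j.
    by rewrite mulmxBl [RHS]addrC addrA subrK.
  apply: le_trans (is_normD N2_norm _ _) _; rewrite lerD2l.
  have -> : c * eps * T `^ (- e) = C2 * (q.+1%:R * B * r).
    by rewrite /r /D; field; rewrite ?gt_eqF// (gt_eqF C20) (gt_eqF B0).
  apply: HC2; first by rewrite mulr_ge0 ?(ltW r0)// mulr_ge0 ?(ltW B0).
  move=> i; rewrite mxE; apply: le_trans (ler_norm_sum _ _ _) _.
  apply: (@le_trans _ _ (\sum_(k < q) r * B)).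
    by apply: ler_sum => k _; rewrite !mxE normrM; apply: ler_pM.
  rewrite sumr_const card_ord -[leLHS]mulr_natl -[leRHS]mulrA [B * r]mulrC.
  by apply: ler_wpM2r; [rewrite mulr_ge0 ?(ltW r0) ?(ltW B0)|rewrite ler_nat].
have int_le (j : 'cV[int]_q) k : M (map_mx intr j) <= M (map_mx intr b) + T ->
    `|(j k 0)%:~R| <= B :> R.
  move=> Hj; have := HC1 (map_mx intr j) k; rewrite mxE => /le_trans; apply.
  by rewrite ler_wpM2l// ltW.
split.
  exists y; apply: le_trans (pert W' W b y HW' _) _.
    by move=> k; apply: int_le; rewrite lerDl ltW.
  by move: Hy; lra.
move=> j z j0 jT; have := low j z j0 jT.
have H : N2 (W *m map_mx intr j + map_mx intr z) <=
    N2 (W' *m map_mx intr j + map_mx intr z) + c * eps * T `^ (- e).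
  apply: pert => [i k|k]; first by rewrite distrC.
  apply: int_le; rewrite (le_trans (ltW jT))// lerDr; exact: is_norm_ge0.
lra.
Qed.

(** [Inv W b] is kept abstract to serve both constructions: in each it makes [W] rational along [b],
    with [b] an exact relation, plus the arithmetic needed for the next step. *)
Definition extensible_peaks : Prop :=
  exists (Inv : 'M[R]_(m, q) -> 'cV[int]_q -> Prop) (W0 : 'M[R]_(m, q)) (b0 : 'cV[int]_q),
    Inv W0 b0 /\
    forall W b (eps T : R), Inv W b -> 0 < eps -> exists W' b',
      [/\ Inv W' b', forall i j, `|W' i j - W i j| <= eps,
          T <= M (map_mx intr b') & psi_peak eps W' b b'].

Lemma iterate_peaks : extensible_peaks ->
  exists W b, [/\ 1 <= M (map_mx intr (b 0)),
    forall k, k.+2%:R * M (map_mx intr (b k)) <= M (map_mx intr (b k.+1)) &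
    forall k, psi_peak k.+1%:R^-1 W (b k) (b k.+1)].
Proof.
move=> [Inv [W0 [b0 [inv0 step]]]].
pose st := ('M[R]_(m, q) * 'cV[int]_q * R)%type.
pose good (s : st) := [/\ Inv s.1.1 s.1.2, 1 <= M (map_mx intr s.1.2) & 0 < s.2].
have next k (s : st) : exists s' : st, good s ->
    [/\ good s', forall i j, `|s'.1.1 i j - s.1.1 i j| + s'.2 <= s.2,
        k.+2%:R * M (map_mx intr s.1.2) <= M (map_mx intr s'.1.2) &
        forall W : 'M[R]_(m, q), (forall i j, `|W i j - s'.1.1 i j| <= s'.2) ->
          psi_peak k.+1%:R^-1 W s.1.2 s'.1.2].
  have [[inv M1 r0]|] := pselect (good s); last by move=> ng; exists s => /ng.
  (* Half of the old radius for the move of the centre leaves half for the new radius, so the balls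
     are nested; the tolerance is halved because openness doubles it. *)
  pose eps := Num.min (s.2 / 2) (k.+1%:R^-1 / 2).
  have eps0 : 0 < eps by rewrite lt_min !divr_gt0// invr_gt0.
  have [W' [b' [inv' near' T' peak]]] :=
    step _ _ eps (Num.max 1 (k.+2%:R * M (map_mx intr s.1.2))) inv eps0.
  move: T'; rewrite ge_max => /andP[M1' T'].
  have Mb' : 0 < M (map_mx intr b') by rewrite (lt_le_trans _ M1').
  have k0 : 0 < k.+1%:R^-1 / 2 :> R by rewrite divr_gt0// invr_gt0.
  have peak' : psi_peak (k.+1%:R^-1 / 2) W' s.1.2 b'.
    have epsk : eps <= k.+1%:R^-1 / 2 by rewrite ge_min lexx orbT.
    have P0 : 0 < c * M (map_mx intr b') `^ (- e) by rewrite mulr_gt0// powR_gt0.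
    have := ler_wpM2l (ltW P0) epsk => h.
    move: h; set u := _ / 2 => h.
    case: peak => -[y Hy] low; split; first by exists y; move: Hy h; lra.
    by move=> j z j0 jT; move: (low j z j0 jT) h; lra.
  have [r r0' Heta] := psi_peak_open k0 Mb' peak'.
  exists (W', b', Num.min r (s.2 / 2)) => _; split => //=.
  - by split => //=; rewrite lt_min r0' divr_gt0.
  - move=> i j; have := near' i j; have : eps <= s.2 / 2 by rewrite ge_min lexx.
    have : Num.min r (s.2 / 2) <= s.2 / 2 by rewrite ge_min lexx orbT.
    by lra.
  - move=> W HW; have -> : k.+1%:R^-1 = 2 * (k.+1%:R^-1 / 2) :> R.
      by rewrite mulrC divfK.
    by apply: Heta => i j; apply: le_trans (HW i j) _; rewrite ge_min lexx.
(* A preliminary step whose peak is discarded; it only makes the first length at least 1. *)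
have [W1 [b1 [inv1 _ M1 _]]] := step _ _ 1 1 inv0 ltr01.
have [g Hg] := choice (fun k => ex_intro _ _ (projT2 (choice (next k)))).
pose s := fix s k : st := if k is k'.+1 then g k' (s k') else (W1, b1, 1).
have gs k : good (s k) by elim: k => [|k IH] //; have [] := Hg k _ IH.
have near k l : (k <= l)%N ->
    forall i j, `|(s l).1.1 i j - (s k).1.1 i j| + (s l).2 <= (s k).2.
  elim: l => [|l IH]; first by rewrite leqn0 => /eqP -> i j; rewrite subrr normr0 add0r.
  rewrite leq_eqVlt => /orP[/eqP -> i j|/IH kl i j].
    by rewrite subrr normr0 add0r.
  have [_ h _ _] := Hg l _ (gs l); have := kl i j; have := h i j.
  have := ler_distD ((s l).1.1 i j) ((s l.+1).1.1 i j) ((s k).1.1 i j).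
  by rewrite /=; lra.
have nested i j k l : (s k).1.1 i j - (s k).2 <= (s l).1.1 i j + (s l).2.
  have [kl|/ltnW lk] := leqP k l.
    have := near _ _ kl i j; have [_ _ h] := gs l.
    have := ler_norm ((s k).1.1 i j - (s l).1.1 i j); rewrite distrC; lra.
  have := near _ _ lk i j; have [_ _ h] := gs k.
  have := ler_norm ((s k).1.1 i j - (s l).1.1 i j); lra.
pose w i j := xget 0 (fun y => forall k, (s k).1.1 i j - (s k).2 <= y <= (s k).1.1 i j + (s k).2).
exists (\matrix_(i, j) w i j), (fun k => (s k).1.2); split.
- by have [] := gs 0%N.
- by move=> k; have [] := Hg k _ (gs k).
- move=> k; have [_ _ _] := Hg k _ (gs k); apply => i j.
  rewrite mxE /w; case: xgetP => [y -> /(_ k.+1) /andP[h1 h2]|].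
    by rewrite ler_norml -/(s k.+1); apply/andP; split; lra.
  by have [y Hy] := nested_intervals (nested i j) => /(_ y).
Qed.

End iteration.

(** * One column *)


Lemma no_wrap (E G u v : int) : 0 < E -> G <= E ->
  2 * `|E * u + v| < G -> 2 * `|v| <= E -> u = 0.
Proof.
move=> E0 GE h1 h2.
have h3 : `|E * u| < E.
  have := ler_normB (E * u + v) v; rewrite addrK; lia.
move: h3; rewrite normrM (gtr0_norm E0) -[ltRHS]mulr1 ltr_pM2l//; lia.
Qed.

(** Induction on [t]: a bound below [g ^ (m - 1)] at [t] becomes one below [g ^ m] at [t + 1]. There
    the multiple of [g ^ m] must vanish, and the smallness of the value restores the stronger
    bound. *)
Lemma no_wrap_chain (g j : int) (m l : nat) (u : nat -> int) : 2 <= g -> (0 < m)%N ->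
  2 * `|j| <= g ^+ m ->
  (forall t, (t < l)%N -> 2 * `|g ^+ m * u t + j * g ^+ t| < g ^+ m.-1) ->
  forall t, (t < l)%N -> 2 * `|j| * g ^+ t < g ^+ m.-1.
Proof.
move=> g2 m0 jE Hu.
have g0 : 0 < g by lia.
have gm : g ^+ m = g * g ^+ m.-1 by rewrite -exprS prednK.
have E0 : 0 < g ^+ m by rewrite exprn_gt0.
have G0 : 0 < g ^+ m.-1 by rewrite exprn_gt0.
have GE : g ^+ m.-1 <= g ^+ m by rewrite gm ler_peMl//; lia.
have key t : (t < l)%N -> 2 * `|j| * g ^+ t <= g ^+ m -> 2 * `|j| * g ^+ t < g ^+ m.-1.
  move=> tl h; have nt : `|j * g ^+ t| = `|j| * g ^+ t.
    by rewrite normrM (gtr0_norm (exprn_gt0 _ g0)).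
  have u0 : u t = 0.
    by apply: (no_wrap E0 GE (Hu t tl)); rewrite nt mulrA.
  by have := Hu t tl; rewrite u0 mulr0 add0r nt mulrA.
elim=> [|t IH] tl; first by apply: key => //; rewrite expr0 mulr1.
apply: key => //; have := IH (ltnW tl).
by rewrite exprS mulrCA gm => h; rewrite ler_pM2l// ltW.
Qed.

Lemma centered_division (E j : int) : 0 < E ->
  exists k j', j = j' + k * E /\ 2 * `|j'| <= E.
Proof.
move=> E0; exists (divz (2 * j + E) (2 * E)), (j - divz (2 * j + E) (2 * E) * E).
split; first by rewrite subrK.
have := divz_eq (2 * j + E) (2 * E); have := modz_ge0 (2 * j + E) (_ : 2 * E != 0).
have := ltz_pmod (2 * j + E) (_ : 0 < 2 * E).
set k := divz _ _; set r := modz _ _ => h1 h2 h3.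
have {}h1 : r < 2 * E by apply: h1; lia.
have {}h2 : 0 <= r by apply: h2; lia.
lia.
Qed.

(* All the coordinates of [v] being small forces [j'], the residue of [j] modulo
   [E] of least absolute value, to be a nonzero multiple of [Q]. *)
Lemma one_column_multiple (g Q : int) (m n a : nat) (P z y : 'I_m -> int) (j : int)
    (il is_ : 'I_m) :
  2 <= g -> (n < m)%N -> (1 < n)%N -> Q = 2 ^+ a -> (Q %| g)%Z -> (2 %| g)%Z ->
  il = (m - n)%N :> nat ->
  (forall i : 'I_m, (0 < i)%N -> (i <= m - n)%N -> z i = g ^+ (m - n - i)) ->
  (forall i : 'I_m, i = 0%N :> nat -> 0 <= z i <= g ^+ (m - n)) ->
  (forall i : 'I_m, (m - n < i)%N -> 0 <= z i <= 1) ->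
  (P il = 1 %[mod 2])%Z -> (P is_ - z is_ * P il = 1 %[mod 2])%Z ->
  j != 0 -> `|j| < Q * g ^+ m ->
  (forall i, 2 * `|j * (g ^+ m * P i + z i) + Q * g ^+ m * y i| < g ^+ m.-1) ->
  exists j' : int, Q <= `|j'| /\
    forall i, j * (g ^+ m * P i + z i) + Q * g ^+ m * y i = j' * z i.
Proof.
move=> g2 nm n1 Qa Qg g_even ilE zmid z0 zend Pl Ps j0 jQ Hv.
have g0 : 0 < g by lia.
have m0 : (0 < m)%N by apply: leq_ltn_trans nm.
have E0 : 0 < g ^+ m by rewrite exprn_gt0.
have Q0 : 0 < Q by rewrite Qa exprn_gt0.
have GE : g ^+ m.-1 <= g ^+ m by rewrite -(prednK m0) exprS ler_peMl ?exprn_ge0//; lia.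
have [k [j' [jE j'E]]] := centered_division j E0.
(* The value on row [i] is [g ^ m * u i + j' * z i]; the aim is to show that no [u i] differs from
   0. *)
pose u i := j * P i + Q * y i + k * z i.
have vE i : j * (g ^+ m * P i + z i) + Q * g ^+ m * y i = g ^+ m * u i + j' * z i.
  by rewrite /u (_ : j' = j - k * g ^+ m); [ring|rewrite jE addrK].
have chain t : (t < m - n)%N -> 2 * `|j'| * g ^+ t < g ^+ m.-1.
  pose idx t : 'I_m := insubd il (m - n - t)%N.
  apply: (@no_wrap_chain g j' m (m - n) (fun t => u (idx t))) => // {}t tl.
  have idxE : idx t = (m - n - t)%N :> nat by rewrite val_insubd; case: ifP => //; lia.
  have := Hv (idx t); rewrite vE zmid ?idxE; [|lia|lia].
  by rewrite subKn// ltnW.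
have zge i : 0 <= z i.
  have [i0|i0] := posnP i; first by have /andP[] := z0 i i0.
  have [il'|il'] := leqP i (m - n); last by have /andP[] := zend i il'.
  by rewrite zmid// exprn_ge0// ltW.
(* The chain controls [|j'|] times [g ^ (m - n - 1)]; one more factor [g] still fits under [g ^ m],
   which covers row 0. *)
have small i : 2 * `|j' * z i| <= g ^+ m.
  rewrite normrM (ger0_norm (zge i)) mulrA.
  have gm : g ^+ m = g * g ^+ m.-1 by rewrite -exprS prednK.
  have [i0|i0] := posnP i.
    have /andP[_ h] := z0 i i0.
    apply: (@le_trans _ _ (2 * `|j'| * g ^+ (m - n))); first by rewrite ler_wpM2l.
    have := chain (m - n).-1; rewrite ltn_predL subn_gt0 => /(_ nm) h2.
    have -> : (m - n = (m - n).-1.+1)%N by rewrite prednK// subn_gt0.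
    by rewrite exprS mulrCA gm ler_pM2l// ltW.
  have [il'|il'] := leqP i (m - n).
    rewrite zmid//; apply/ltW/(lt_le_trans _ GE)/chain; lia.
  have /andP[_ h] := zend i il'; apply: le_trans j'E.
  by rewrite ler_piMr// mulr_ge0.
have u0 i : u i = 0 by apply: (no_wrap E0 GE _ (small i)); rewrite -vE.
have QE : (Q %| g ^+ m)%Z by rewrite -(prednK m0) exprS dvdz_mulr.
have key i : (Q %| j' * P i + k * z i)%Z.
  have -> : j' * P i + k * z i = u i - k * g ^+ m * P i - Q * y i by rewrite /u jE; ring.
  rewrite u0 sub0r; apply: rpredB; last by apply: dvdz_mulr; exact: dvdzz.
  by rewrite rpredN; apply: dvdz_mulr; apply: dvdz_mull.
have zl : z il = 1 by rewrite zmid ilE ?subnn// subn_gt0.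
have Qj' : (Q %| j')%Z.
  (* Eliminating [k] between the rows [il] and [is_] leaves [j'] times an odd number, which is
     invertible modulo the power of two [Q]. *)
  have Qd : (Q %| (P is_ - z is_ * P il) * j')%Z.
    have -> : (P is_ - z is_ * P il) * j' =
        (j' * P is_ + k * z is_) - z is_ * (j' * P il + k * z il) by rewrite zl; ring.
    by apply: rpredB => //; apply: dvdz_mull.
  rewrite -(Gauss_dvdzr _ (_ : coprimez Q (P is_ - z is_ * P il)))//.
  rewrite Qa coprimezXl//; move: Ps; set x := P is_ - _ => Ps.
  by rewrite /coprimez -gcdz_modr Ps.
exists j'; split; last first.
  by move=> i; rewrite vE u0 mulr0 add0r.
have [j'0|j'n0] := eqVneq j' 0; last first.
  have /dvdzP[x j'x] := Qj'; rewrite j'x normrM (gtr0_norm Q0).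
  rewrite ler_peMl ?(ltW Q0)// -gtz0_ge1 normr_gt0.
  by apply: contraNneq j'n0 => x0; rewrite j'x x0 mul0r.
(* If [j' = 0], row [il], where [z] is 1, gives [Q | k]. Then [Q g ^ m] divides the nonzero [j],
   against its size. *)
exfalso; have := key il; rewrite j'0 mul0r add0r zl mulr1 => /dvdzP[x kx].
move: jQ; rewrite jE j'0 add0r kx -mulrA normrM (gtr0_norm (mulr_gt0 Q0 E0)).
rewrite -[ltRHS]mul1r ltr_pM2r ?mulr_gt0// => x1.
have x0 : x = 0 by move: x1; rewrite -[1]add0r ltzD1 normr_le0 => /eqP.
by move: j0; rewrite jE j'0 add0r kx x0 !mul0r eqxx.
Qed.

Lemma odd_minor (x l : int) : (l = 1 %[mod 2])%Z ->
  (x - modz (x + 1) 2 * l = 1 %[mod 2])%Z.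
Proof.
move=> l1; have hx := divz_eq (x + 1) 2; have hl := divz_eq l 2.
move: hx hl; rewrite l1 (_ : modz 1 2 = 1)//.
have : 0 <= modz (x + 1) 2 < 2 by rewrite modz_ge0//= ltz_pmod.
move: (modz (x + 1) 2) (divz (x + 1) 2) (divz l 2) => r u v r01 hx ->.
have -> : x = u * 2 + r - 1 by rewrite -hx addrK.
have -> : u * 2 + r - 1 - r * (v * 2 + 1) = (u - r * v - 1) * 2 + 1 by ring.
by rewrite modzMDl.
Qed.

Lemma subn_le_pred (k i : nat) : (0 < i)%N -> (k - i <= k.-1)%N.
Proof. lia. Qed.

Lemma subn_lt_pred (m n : nat) : (1 < n)%N -> (n < m)%N -> (m - n < m.-1)%N.
Proof. lia. Qed.


Lemma powR_exprV (R : realType) (m n : nat) (x y : R) : (0 < m)%N -> 0 <= x -> 0 <= y ->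
  (x * y ^+ m) `^ (- (n%:R / m%:R)) = x `^ (- (n%:R / m%:R)) / y ^+ n.
Proof.
move=> m0 x0 y0; rewrite powRM ?exprn_ge0//; congr (_ * _).
rewrite -powR_mulrn// -powRrM mulrN mulrCA divff ?mulr1; last first.
  by rewrite pnatr_eq0 -lt0n.
by rewrite powR_invn.
Qed.

Section one_column.
Context {R : realType} {m n : nat}.
Variables (M : 'cV[R]_1 -> R) (N2 : 'cV[R]_m -> R).
Hypothesis (M_norm : is_norm M) (N2_norm : is_norm N2).
Hypothesis (n_gt1 : (1 < n)%N) (nm : (n < m)%N).

Let m0 : (0 < m)%N. Proof. exact: leq_ltn_trans nm. Qed.
Let i0 : 'I_m := Ordinal m0.
Let il_proof : (m - n < m)%N. Proof. by rewrite ltn_subrL m0 (ltnW n_gt1). Qed.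
Let il : 'I_m := Ordinal il_proof.
Let is_proof : (m.-1 < m)%N. Proof. by rewrite prednK. Qed.
Let is_ : 'I_m := Ordinal is_proof.
Let e : R := n%:R / m%:R.
Let nu := M (const_mx 1).
Let f0 : 'cV[R]_m := delta_mx i0 0.
Let kappa := N2 f0.

Let M_int (v : 'cV[int]_1) : M (map_mx intr v) = `|(v 0 0)%:~R| * nu.
Proof.
rewrite /nu -(is_normZ M_norm); congr M; apply/colP => i.
by rewrite !mxE (ord1 i) mulr1.
Qed.

Let nu0 : 0 < nu.
Proof.
rewrite lt_neqAle (is_norm_ge0 M_norm) andbT eq_sym; apply/eqP => /(is_norm_eq0 M_norm).
by move=> /colP/(_ 0); rewrite !mxE => /eqP; rewrite oner_eq0.
Qed.

Let kappa0 : 0 < kappa.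
Proof.
rewrite lt_neqAle (is_norm_ge0 N2_norm) andbT eq_sym; apply/eqP => /(is_norm_eq0 N2_norm).
by move=> /colP/(_ i0); rewrite !mxE !eqxx => /eqP; rewrite oner_eq0.
Qed.

(** Here [b] is an exact relation of [W]. The odd numerator at [il] is what allows the next step to
    make a minor odd. *)
Definition dyadic_column (W : 'M[R]_(m, 1)) (b : 'cV[int]_1) : Prop :=
  exists a : nat, exists P : 'I_m -> int,
    [/\ b 0 0 = 2 ^+ a, forall i, W i 0 = (P i)%:~R / 2 ^+ a & (P il = 1 %[mod 2])%Z].

Lemma one_column_step (c : R) : 0 < c -> c * nu `^ (- e) <= kappa ->
  forall W b (eps T : R), dyadic_column W b -> 0 < eps -> exists W' b',
     [/\ dyadic_column W' b', forall i j, `|W' i j - W i j| <= eps,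
         T <= M (map_mx intr b') & psi_peak M N2 c e eps W' b b'].
Proof.
move=> c0 ck W b eps T [a [P [ba WP Pl]]] eps0.
have [C2 C20 HC2] := norm_le_entries N2_norm.
have [C3 C30 HC3] := entries_le_norm N2_norm.
pose Q : R := 2 ^+ a.
have Q1 : 1 <= Q by rewrite exprn_ege1// ler1n.
have Q0 : 0 < Q by rewrite (lt_le_trans _ Q1).
(* Chosen so that [lam kappa G ^ (m - n) / G ^ m], the intended norm of the old relation at the new
   column, equals [c M(b') ^ (- e)] with [M(b') = Q nu G ^ m] and [e = n / m]. *)
have [lam lamE] : exists lam, lam = c * (Q * nu) `^ (- e) / kappa by eexists.
have lam0 : 0 < lam by rewrite lamE divr_gt0// mulr_gt0// powR_gt0// mulr_gt0.
(* This is where [c] has to be small: it keeps entry 0 of [z] at most [g ^ (m - n)]. *)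
have lam1 : lam <= 1.
  rewrite lamE ler_pdivrMr// mul1r; apply: le_trans ck; rewrite ler_wpM2l ?(ltW c0)//.
  rewrite !powRN lef_pV2 ?posrE ?powR_gt0 ?mulr_gt0//; apply: ge0_ler_powR.
  - by rewrite divr_ge0.
  - by rewrite nnegrE ltW.
  - by rewrite nnegrE mulr_ge0// ltW.
  - by rewrite ler_peMl// ltW.
(* In order: closeness of the new column, length of [b'], negligibility of the entries of [z] other
   than entry 0, and the lower bound for values with a large numerator. *)
pose big := eps^-1 + `|T| / nu + C2 / (eps * lam * kappa) + 2 * Q * C3 * (lam * kappa).
pose h := maxn (maxn 1 a) (Num.truncn big).+1.
have [g gE] : exists g : int, g = 2 ^+ h by eexists.
have [G GE] : exists G : R, G = 2 ^+ h by eexists.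
have gG : g%:~R = G by rewrite gE GE rmorphXn.
have Gbig : big <= G.
  rewrite (le_trans (ltW (truncnS_gt _)))// GE -natrX ler_nat.
  apply: (@leq_trans h); first by rewrite leq_max leqnn orbT.
  exact/ltnW/ltn_expl.
have elk0 : 0 < eps * lam * kappa by rewrite mulr_gt0// mulr_gt0.
have [t1 t2 t3 t4] : [/\ 0 <= eps^-1, 0 <= `|T| / nu, 0 <= C2 / (eps * lam * kappa) &
    0 <= 2 * Q * C3 * (lam * kappa)].
  split; rewrite ?invr_ge0 ?(ltW eps0)//.
  - by rewrite divr_ge0// ltW.
  - by rewrite divr_ge0 ?(ltW C20) ?(ltW elk0).
  - by rewrite !mulr_ge0 ?(ltW Q0) ?(ltW C30) ?(ltW lam0) ?(ltW kappa0).
have [G1 G2 G3 G4] : [/\ eps^-1 <= G, `|T| / nu <= G, C2 / (eps * lam * kappa) <= G &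
    2 * Q * C3 * (lam * kappa) <= G].
  by move: Gbig; rewrite /big => Gbig; split; lra.
have h1 : (1 <= h)%N by rewrite !leq_max leqnn.
have ha : (a <= h)%N by rewrite !leq_max leqnn orbT.
have Gge2 : 2 <= G by rewrite GE -(prednK h1) exprS ler_peMr// exprn_ege1// ler1n.
have Gge1 : 1 <= G by apply: le_trans Gge2; rewrite ler1n.
have ilE : il = (m - n)%N :> nat by [].
have G0 : 0 < G by rewrite (lt_le_trans _ Gge2).
have g2 : 2 <= g by rewrite gE -(prednK h1) exprS ler_peMr// exprn_ege1.
have Qg : ((2 : int) ^+ a %| g)%Z by rewrite gE -(subnK ha) exprD dvdz_mull.
have g_even : (2 %| g)%Z by rewrite gE -(prednK h1) exprS dvdz_mulr.
have g0 : 0 <= g by apply: le_trans g2.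
(* [z / g ^ m] is the value of the old relation at the new column.  Its entry 0 sets
   the norm, the next entries expose the base [g] digits of a residue one at a time,
   and the entry [is_] makes the minor on [il], [is_] of [P] and [z] odd. *)
pose z (i : 'I_m) : int :=
  if i == 0%N :> nat then Num.floor (lam * G ^+ (m - n))
  else if (i <= m - n)%N then g ^+ (m - n - i)
  else if i == is_ then modz (P i + 1) 2 else 0.
have mn0 : (0 < m - n)%N by rewrite subn_gt0.
have lG0 : 0 <= lam * G ^+ (m - n) by rewrite mulr_ge0 ?exprn_ge0 ?(ltW lam0) ?(ltW G0).
have zmid (i : 'I_m) : (0 < i)%N -> (i <= m - n)%N -> z i = g ^+ (m - n - i).
  by move=> i1 i2; rewrite /z -(negbK (i == 0%N :> nat)) -lt0n i1 /= i2.
have z0 (i : 'I_m) : i = 0%N :> nat -> 0 <= z i <= g ^+ (m - n).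
  move=> iE; rewrite /z iE eqxx; apply/andP; split; first by rewrite floor_ge0.
  rewrite -(ler_int R) rmorphXn /= gG; apply: le_trans (floor_le_tmp _) _.
  by rewrite ler_piMl// exprn_ge0// ltW.
have zend (i : 'I_m) : (m - n < i)%N -> 0 <= z i <= 1.
  move=> i1; rewrite /z ifF; last by apply/negbTE; rewrite -lt0n (leq_trans _ i1).
  rewrite leqNgt i1 /=; case: ifP => // _; rewrite modz_ge0//=.
  by rewrite -ltzD1 ltz_pmod.
have zl : z il = 1 by rewrite zmid//= subnn.
have isl : (m - n < is_)%N by rewrite /= subn_lt_pred.
have Ps : (P is_ - z is_ * P il = 1 %[mod 2])%Z.
  have zs : z is_ = modz (P is_ + 1) 2.
    rewrite /z ifF; last by apply/negbTE; rewrite -lt0n (leq_trans _ isl).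
    by rewrite leqNgt isl /= eqxx.
  by rewrite zs odd_minor.
pose P' i : int := g ^+ m * P i + z i.
pose a' := (a + h * m)%N.
have Q' : (2 : R) ^+ a' = Q * G ^+ m by rewrite exprD exprM ?GE ?gE.
have Q'i : (2 : int) ^+ a' = 2 ^+ a * g ^+ m by rewrite exprD exprM ?GE ?gE.
pose W' : 'M[R]_(m, 1) := \matrix_(i, j) ((P' i)%:~R / 2 ^+ a').
pose b' : 'cV[int]_1 := const_mx (2 ^+ a').
have Gm0 : 0 < G ^+ m by rewrite exprn_gt0.
have Gn0 : 0 < G ^+ n by rewrite exprn_gt0.
have P'R i : (P' i)%:~R = G ^+ m * (P i)%:~R + (z i)%:~R :> R.
  by rewrite /P' intrD intrM rmorphXn /= gG.
have GGm : G ^+ m = G ^+ n * G ^+ (m - n) by rewrite -exprD subnKC// ltnW.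
have GG1 : G ^+ (m - n) = G * G ^+ (m - n).-1 by rewrite -exprS prednK.
have G1n : 1 <= G ^+ (m - n).-1 by rewrite exprn_ege1.
have zapprox (i : 'I_m) : `|(z i)%:~R - lam * G ^+ (m - n) * f0 i 0| <= G ^+ (m - n).-1.
  rewrite /f0 mxE eqxx andbT.
  have [iE|ine] := eqVneq i i0.
    rewrite mulr1 iE /z /= distrC ger0_norm; last by rewrite subr_ge0 floor_le_tmp.
    have := floorD1_gt (lam * G ^+ (m - n)); rewrite intrD; lra.
  rewrite mulr0 subr0; have ip : (0 < i)%N by rewrite lt0n.
  have [il'|il'] := leqP i (m - n).
    rewrite zmid// rmorphXn /= gG ger0_norm ?exprn_ge0 ?(ltW G0)//.
    by apply: ler_weXn2l; [exact: Gge1|exact: subn_le_pred].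
  have /andP[h2 h3] := zend i il'; rewrite ger0_norm ?ler0z//.
  by apply: le_trans G1n; rewrite (_ : 1 = (1 : int)%:~R)// ler_int.
pose zv : 'cV[R]_m := \col_i (z i)%:~R.
have zvE : N2 zv <= (1 + eps) * (lam * kappa * G ^+ (m - n)) /\
           (1 - eps) * (lam * kappa * G ^+ (m - n)) <= N2 zv.
  have d0 : C2 * G ^+ (m - n).-1 <= eps * (lam * kappa * G ^+ (m - n)).
    rewrite GG1 [X in _ <= X](_ : _ = (G * (eps * lam * kappa)) * G ^+ (m - n).-1); last ring.
    by rewrite ler_wpM2r ?(le_trans _ G1n)// -ler_pdivrMr ?mulr_gt0.
  pose r := zv - (lam * G ^+ (m - n)) *: f0.
  have Nr : N2 r <= C2 * G ^+ (m - n).-1.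
    apply: HC2 => [|i]; first by rewrite (le_trans _ G1n).
    by have := zapprox i; rewrite !mxE.
  have Nf : N2 ((lam * G ^+ (m - n)) *: f0) = lam * kappa * G ^+ (m - n).
    by rewrite (is_normZ N2_norm) ger0_norm// -/kappa mulrAC.
  have h2 : N2 zv <= N2 r + N2 ((lam * G ^+ (m - n)) *: f0).
    by rewrite -{1}(subrK ((lam * G ^+ (m - n)) *: f0) zv) (is_normD N2_norm).
  have h3 : N2 ((lam * G ^+ (m - n)) *: f0) <= N2 r + N2 zv.
    rewrite -(is_normN N2_norm r); apply: le_trans (is_normD N2_norm _ _).
    by rewrite /r opprB subrK.
  move: h2 h3 Nr d0; rewrite Nf; move: (N2 zv) (N2 r) (lam * kappa * _) (C2 * _).
  by move=> x y u w *; split; lra.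
have Mb' : M (map_mx intr b') = Q * nu * G ^+ m.
  by rewrite M_int mxE rmorphXn /= ger0_norm ?exprn_ge0// Q' mulrAC.
have deltaE : c * M (map_mx intr b') `^ (- e) = lam * kappa * G ^+ (m - n) / G ^+ m.
  rewrite Mb' powR_exprV ?mulr_ge0 ?(ltW Q0) ?(ltW nu0) ?(ltW G0)// -/e GGm.
  by rewrite lamE; field; rewrite !gt_eqF// exprn_gt0.
exists W', b'; split.
- exists a', P'; split; first by rewrite mxE.
    by move=> i; rewrite mxE.
  rewrite /P' zl; have /dvdzP[x ->] := g_even.
  by rewrite -(prednK m0) exprS -!mulrA mulrCA -modzDml modzMr add0r.
- move=> i j; rewrite (ord1 j) mxE WP P'R Q' -/Q.
  have -> : (G ^+ m * (P i)%:~R + (z i)%:~R) / (Q * G ^+ m) - (P i)%:~R / Q =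
     (z i)%:~R / (Q * G ^+ m) by field; rewrite !gt_eqF.
  have zG : `|(z i)%:~R : R| <= G ^+ (m - n).
    have [ip|ip] := posnP i.
      have /andP[h2 h3] := z0 i ip; rewrite ger0_norm ?ler0z//.
      by rewrite -gG -rmorphXn /= ler_int.
    have [il'|il'] := leqP i (m - n).
      rewrite zmid// rmorphXn /= gG ger0_norm ?exprn_ge0 ?(ltW G0)//.
      by apply: ler_weXn2l; [exact: Gge1|exact: leq_subr].
    have /andP[h2 h3] := zend i il'; rewrite ger0_norm ?ler0z//.
    apply: (@le_trans _ _ 1); last by rewrite exprn_ege1.
    by rewrite (_ : 1 = (1 : int)%:~R)// ler_int.
  rewrite normrM normfV (gtr0_norm (mulr_gt0 Q0 Gm0)) ler_pdivrMr ?mulr_gt0//.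
  apply: le_trans zG _; rewrite GGm.
  have e1 : 1 <= eps * G by rewrite -ler_pdivrMl// mulr1.
  have h2 : G <= G ^+ n by rewrite -{1}[G]expr1 ler_weXn2l// ltnW.
  rewrite -[leLHS]mul1r !mulrA ler_wpM2r ?exprn_ge0 ?(ltW G0)//.
  apply: le_trans e1 _; rewrite -mulrA ler_wpM2l ?(ltW eps0)//.
  by apply: le_trans h2 _; rewrite ler_peMl// ltW.
- rewrite Mb'; apply: le_trans (ler_norm T) _.
  move: G2; rewrite ler_pdivrMr// => h2; apply: (le_trans h2).
  have h3 : G <= G ^+ m by rewrite -{1}[G]expr1 ler_weXn2l.
  rewrite mulrC -mulrA -[leLHS]mul1r; apply: ler_pM => //.
    by rewrite mulr_ge0 ?ltW.
  by rewrite ler_wpM2l// ltW.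
- split.
    exists (\col_i (- P i)).
    have -> : W' *m map_mx intr b + map_mx intr (\col_i (- P i)) = (G ^+ m)^-1 *: zv.
      apply/colP => i; rewrite !mxE big_ord1 !mxE P'R Q' ba rmorphXn /= intrN -/Q.
      by field; rewrite !gt_eqF.
    rewrite (is_normZ N2_norm) gtr0_norm ?invr_gt0// -[c * _ * _]mulrAC.
    rewrite [_ * (1 + eps)]mulrC deltaE [leLHS]mulrC [leRHS]mulrA ler_pM2r ?invr_gt0//.
    by case: zvE.
  move=> j y j0 jM.
  have jQ : `|j 0 0| < 2 ^+ a * g ^+ m.
    move: jM; rewrite !M_int ltr_pM2r// mxE -!intr_norm ltr_int => jM.
    by rewrite -Q'i; apply: lt_le_trans jM _; rewrite ger0_norm// exprn_ge0.
  have j00 : j 0 0 != 0.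
    by apply: contraNneq j0 => j00; apply/eqP/colP => i; rewrite (ord1 i) j00 mxE.
  pose v i := j 0 0 * (g ^+ m * P i + z i) + 2 ^+ a * g ^+ m * y i 0.
  have VE i : (W' *m map_mx intr j + map_mx intr y) i 0 = (v i)%:~R / (Q * G ^+ m).
    rewrite !mxE big_ord1 !mxE P'R Q' /v.
    rewrite !(intrD, intrM) !rmorphXn /= gG -/Q; field.
    by rewrite !gt_eqF.
  have [vsmall|/existsNP[i]] := pselect (forall i, 2 * `|v i| < g ^+ m.-1).
    have [j' [Qj' vE]] := one_column_multiple g2 nm n_gt1 erefl Qg g_even ilE
       zmid z0 zend Pl Ps j00 jQ vsmall.
    have -> : W' *m map_mx intr j + map_mx intr y = (j'%:~R / (Q * G ^+ m)) *: zv.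
      by apply/colP => i; rewrite VE /v vE !mxE intrM mulrAC.
    rewrite (is_normZ N2_norm) normrM normfV (gtr0_norm (mulr_gt0 Q0 Gm0)).
    rewrite -[c * _ * _]mulrAC [_ * (1 - eps)]mulrC deltaE; case: zvE => _ h2.
    have Qj'R : Q <= `|j'%:~R|.
      by rewrite -intr_norm /Q (_ : 2 ^+ a = ((2 : int) ^+ a)%:~R) ?ler_int// rmorphXn.
    apply: (@le_trans _ _ (Q / (Q * G ^+ m) * N2 zv)); last first.
      rewrite ler_wpM2r ?(is_norm_ge0 N2_norm)// ler_wpM2r// invr_ge0.
      by rewrite ltW// mulr_gt0.
    have -> : Q / (Q * G ^+ m) = (G ^+ m)^-1 by field; rewrite !gt_eqF.
    by rewrite [leRHS]mulrC [leLHS]mulrA ler_pM2r ?invr_gt0.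
  (* One large numerator makes that coordinate at least [1 / (2 Q G)], while the required bound is
     of order [G ^ (- n)]. Since [n >= 2], the last summand of [big] suffices. *)
  move=> /negP; rewrite -leNgt => vi.
  have Vi : (2 * Q * G)^-1 <= `|(W' *m map_mx intr j + map_mx intr y) i 0|.
    rewrite VE normrM normfV (gtr0_norm (mulr_gt0 Q0 Gm0)) ler_pdivlMr ?mulr_gt0//.
    have vi' : G ^+ m.-1 <= 2 * `|(v i)%:~R|.
      by have := vi; rewrite -(ler_int R) intrM intr_norm rmorphXn /= gG.
    have -> : (2 * Q * G)^-1 * (Q * G ^+ m) = G ^+ m.-1 / 2.
      by rewrite -{1}(prednK m0) exprS; field; rewrite !gt_eqF.
    by rewrite ler_pdivrMr// mulrC.
  rewrite -[c * _ * _]mulrAC [_ * (1 - eps)]mulrC deltaE.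
  have Vi' := le_trans Vi (HC3 _ i).
  rewrite -(ler_pM2l C30); apply: le_trans Vi'.
  apply: (@le_trans _ _ (C3 * (lam * kappa * G ^+ (m - n) / G ^+ m))).
    rewrite ler_wpM2l ?(ltW C30)// ler_piMl ?gerBl ?(ltW eps0)//.
    by rewrite divr_ge0 ?mulr_ge0 ?exprn_ge0 ?ltW.
  have -> : lam * kappa * G ^+ (m - n) / G ^+ m = lam * kappa / G ^+ n.
    by rewrite GGm; field; rewrite !expf_neq0 ?gt_eqF.
  rewrite mulrA ler_pdivrMr// [leRHS]mulrC ler_pdivlMr ?mulr_gt0//.
  have h2 : G * G <= G ^+ n by rewrite -expr2 ler_weXn2l.
  apply: le_trans h2; apply: le_trans (ler_wpM2r (ltW G0) G4).
  by rewrite le_eqVlt; apply/orP; left; apply/eqP; ring.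
Qed.

Lemma one_column_extensible : exists2 c0 : R, 0 < c0 &
  forall c, 0 < c <= c0 -> extensible_peaks M N2 c e.
Proof.
have nue : 0 < nu `^ (- e) by rewrite powR_gt0.
exists (kappa / nu `^ (- e)); first by rewrite divr_gt0.
move=> c /andP[c0 cc]; exists dyadic_column, (const_mx 1), (const_mx 1); split.
  exists 0%N, (fun=> 1); split => //; first by rewrite mxE.
  by move=> i; rewrite mxE expr0 divr1.
move=> W b eps T; apply: one_column_step => //.
by rewrite -ler_pdivlMr.
Qed.

End one_column.

(** * Two columns *)


Lemma ndvd_near (R : realType) (l : nat) (x : R) : (1 < l)%N ->
  exists2 y : int, ~~ (l %| y)%Z & `|y%:~R - x| <= 1.
Proof.
move=> l1; have h1 := floor_le_tmp x; have h2 := floorD1_gt x.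
have [lx|nlx] := boolP (l %| Num.floor x)%Z.
  exists (Num.floor x + 1); last by rewrite ger0_norm; move: h2; rewrite intrD; lra.
  apply/negP => lx1; have := rpredB lx1 lx; rewrite addrAC subrr add0r dvdz1 /=.
  by move=> /eqP l1'; rewrite l1' in l1.
exists (Num.floor x) => //; rewrite distrC ger0_norm ?subr_ge0//.
by move: h2; rewrite intrD; lra.
Qed.

Lemma ndvd_frac_ge (R : realType) (g : nat) (z y : int) : (0 < g)%N -> ~~ (g %| z)%Z ->
  g%:R^-1 <= `|z%:~R / g%:R + y%:~R| :> R.
Proof.
move=> g0 nd; have g0' : (0 : R) < g%:R by rewrite ltr0n.
have -> : z%:~R / g%:R + y%:~R = (z + y * g)%:~R / g%:R :> R.
  by rewrite intrD intrM -pmulrn mulrDl mulfK ?gt_eqF.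
rewrite normrM normfV [`|g%:R|]gtr0_norm// ler_peMl ?invr_ge0 ?(ltW g0')//.
rewrite -intr_norm.
rewrite (_ : 1 = (1 : int)%:~R)// ler_int -gtz0_ge1 normr_gt0.
apply: contra nd => /eqP zy; have -> : z = z + y * g - y * g by rewrite addrK.
by rewrite zy sub0r -mulNr dvdz_mull.
Qed.

Lemma ndvd_mul_pow (l h : nat) (j y : int) : prime l -> ~~ (l %| y)%Z ->
  ~~ ((l ^ h)%N %| j)%Z -> ~~ ((l ^ h)%N %| j * y)%Z.
Proof.
move=> lp ly nd; rewrite Gauss_dvdzl//.
by rewrite coprimezE /= coprimeXl// prime_coprime.
Qed.

Section well_spread.
Context {R : realType} {m n : nat}.
Hypothesis (m0 : (0 < m)%N) (n3 : (2 < n)%N) (mn : (m <= n)%N).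
Let e : R := n%:R / m%:R.
Let i0 : 'I_m := Ordinal m0.

Lemma rate_ge1 : 1 <= e.
Proof. by rewrite /e ler_pdivlMr ?ltr0n// mul1r ler_nat. Qed.

(* For [3 <= m] the denominator is [g ^ 2] and the two base [g] digits of [j] are
   seen on the coordinates 1 and 2, which the perturbation [s] leaves alone. *)
Lemma well_spread_point (l : nat) (zeta : 'I_m -> R) (eps K L B : R) :
  prime l -> 0 < eps -> exists (a : nat) (P : 'I_m -> int),
    [/\ B <= (l ^ a)%:R, forall i, `|(P i)%:~R / (l ^ a)%:R - zeta i| <= eps &
      forall j : int, ~~ ((l ^ a)%N %| j)%Z -> forall (s : R) (y : 'I_m -> int),
        `|s| <= K * (l ^ a)%:R `^ (1 - e) ->
        exists i, L * (l ^ a)%:R `^ (- e) <=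
          `|(j * P i)%:~R / (l ^ a)%:R + s *+ (i == i0) + (y i)%:~R|].
Proof.
move=> lp eps0; have l1 := prime_gt1 lp.
have large (X : R) : exists h0, forall h, (h0 <= h)%N -> X <= (l ^ h)%:R.
  exists (Num.truncn X).+1 => h hh; rewrite (le_trans (ltW (truncnS_gt _)))// ler_nat.
  exact: leq_trans hh (ltnW (ltn_expl _ l1)).
have near_of (a : nat) (P : 'I_m -> int) : eps^-1 <= (l ^ a)%:R ->
    (forall i, `|(P i)%:~R - zeta i * (l ^ a)%:R| <= 1) ->
    forall i, `|(P i)%:~R / (l ^ a)%:R - zeta i| <= eps.
  move=> ea HP i; have Q0 : (0 : R) < (l ^ a)%:R by rewrite ltr0n expn_gt0 (ltnW l1).
  rewrite -[zeta i](mulfK (lt0r_neq0 Q0)) -mulrBl normrM normfV [`|_%:R|]gtr0_norm//.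
  rewrite ler_pdivrMr//; apply: le_trans (HP i) _.
  by rewrite -ler_pdivrMl// mulr1.
have Q0 h : (0 : R) < (l ^ h)%:R by rewrite ltr0n expn_gt0 (ltnW l1).
have [m3|m3] := leqP 3 m.
  pose i1 : 'I_m := Ordinal (leq_trans (isT : 1 < 3)%N m3).
  pose i2 : 'I_m := Ordinal (leq_trans (isT : 2 < 3)%N m3).
  (* For [m = n] the rate is [e = 1], and a gap [1 / Q] with denominator [Q] would not beat
     [L Q ^ (- e)]. With [Q = g ^ 2] the gap is [1 / g = Q ^ (- 1 / 2)], which does. *)
  have e1 : 0 < 2 * e - 1 by have := rate_ge1; lra.
  have [N HN] := powR_nat_unbounded L e1.
  have [h1 Hh1] := large N%:R; have [h2 Hh2] := large (eps^-1); have [h3 Hh3] := large B.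
  pose h := maxn h1 (maxn h2 h3); pose g := (l ^ h)%N.
  have g1 : N%:R <= g%:R :> R by apply: Hh1; rewrite leq_max leqnn.
  have g2 : eps^-1 <= g%:R by apply: Hh2; rewrite !leq_max leqnn orbT.
  have g3 : B <= g%:R by apply: Hh3; rewrite !leq_max leqnn !orbT.
  have g0 : (0 < g)%N by rewrite expn_gt0 (ltnW l1).
  have g0' : (0 : R) < g%:R by exact: Q0.
  have g1' : (1 : R) <= g%:R by rewrite ler1n.
  have gg : (l ^ (h + h) = g * g)%N by rewrite expnD.
  have [y1 ly1 y1E] := ndvd_near (zeta i1 * (g * g)%:R) l1.
  have [y2 ly2 y2E] := ndvd_near (zeta i2 * g%:R) l1.
  pose P i : int := if i == i1 then y1 else if i == i2 then y2 * g
                    else Num.floor (zeta i * (g * g)%:R).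
  exists (h + h)%N, P; rewrite gg natrM; split.
  - by apply: le_trans g3 _; rewrite ler_peMl// ltW.
  - have gV : g%:R^-1 <= eps by rewrite -[eps]invrK lef_pV2 ?posrE ?invr_gt0.
    have D (z : int) (x : R) : `|z%:~R - x * g%:R| <= 1 -> `|z%:~R / g%:R - x| <= eps.
      move=> zx; apply: le_trans gV; rewrite -[x](mulfK (lt0r_neq0 g0')) -mulrBl normrM.
      by rewrite normfV [`|g%:R|]gtr0_norm// ler_piMl// invr_ge0 ltW.
    have D2 (z : int) (x : R) :
        `|z%:~R - x * (g * g)%:R| <= 1 -> `|z%:~R / (g%:R * g%:R) - x| <= eps.
      rewrite natrM => zx; apply: le_trans gV.
      have gg0 : (0 : R) < g%:R * g%:R by rewrite mulr_gt0.
      rewrite -[x](mulfK (lt0r_neq0 gg0)) -mulrBl normrM normfV [`|g%:R * _|]gtr0_norm//.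
      rewrite ler_pdivrMr// [leRHS]mulrA mulVf ?gt_eqF// mul1r.
      by apply: le_trans zx _.
    move=> i; rewrite /P; case: eqVneq => [->|_]; first exact: D2.
    case: eqVneq => [->|_].
      rewrite intrM -pmulrn -mulrA invfM mulrA -mulrA [g%:R * _]mulrA divff ?gt_eqF// mul1r.
      exact: D.
    apply: D2; rewrite distrC ger0_norm ?subr_ge0 ?floor_le_tmp//.
    by have := floorD1_gt (zeta i * (g * g)%:R); rewrite intrD; lra.
  - move=> j nj s y _.
    have rate : L * (g%:R * g%:R) `^ (- e) <= g%:R^-1.
      rewrite powRM ?(ltW g0')// -powRD; last by apply/implyP => _; rewrite gt_eqF.
      have -> : - e + - e = - (2 * e - 1) + -1 by ring.
      rewrite powRD; last by apply/implyP => _; rewrite gt_eqF.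
      rewrite powR_inv1 ?(ltW g0')// mulrA ler_piMl ?invr_ge0 ?(ltW g0')// powRN.
      by rewrite ler_pdivrMr ?powR_gt0// mul1r HN// -(ler_nat R).
    have [gj|ngj] := boolP ((l ^ h)%N %| j)%Z.
      have /dvdzP[j' jE] := gj.
      exists i1; apply: le_trans rate _; rewrite /P eqxx mulr0n addr0 jE -/g.
      have -> : (j' * g * y1)%:~R / (g%:R * g%:R) = (j' * y1)%:~R / g%:R :> R.
        by rewrite !intrM -pmulrn; field; rewrite gt_eqF.
      apply: ndvd_frac_ge => //; apply: ndvd_mul_pow => //.
      apply: contra nj => /dvdzP[x j'x]; rewrite jE j'x -mulrA PoszM.
      by rewrite dvdz_mull.
    exists i2; apply: le_trans rate _; rewrite /P /= mulr0n addr0.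
    have -> : (j * (y2 * g))%:~R / (g%:R * g%:R) = (j * y2)%:~R / g%:R :> R.
      by rewrite !intrM -pmulrn; field; rewrite gt_eqF.
    by apply: ndvd_frac_ge => //; apply: ndvd_mul_pow.
(* For [m <= 2] the rate exceeds 1, so a denominator [g] with gap [1 / g] is enough. *)
have mlt : (m < n)%N by apply: leq_trans m3 _.
have e1 : 0 < e - 1 by rewrite subr_gt0 /e ltr_pdivlMr ?ltr0n// mul1r ltr_nat.
have [N HN] := powR_nat_unbounded (`|K| + `|L|) e1.
have [h1 Hh1] := large N%:R; have [h2 Hh2] := large (eps^-1); have [h3 Hh3] := large B.
have [h4 Hh4] := large (`|K| + `|L|).
pose h := maxn (maxn h1 h4) (maxn h2 h3); pose g := (l ^ h)%N.
have g1 : N%:R <= g%:R :> R by apply: Hh1; rewrite !leq_max leqnn.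
have g2 : eps^-1 <= g%:R by apply: Hh2; rewrite !leq_max leqnn !orbT.
have g3 : B <= g%:R by apply: Hh3; rewrite !leq_max leqnn !orbT.
have g4 : `|K| + `|L| <= g%:R by apply: Hh4; rewrite !leq_max leqnn !orbT.
have g0 : (0 < g)%N by rewrite expn_gt0 (ltnW l1).
have g0' : (0 : R) < g%:R by exact: Q0.
have g1' : (1 : R) <= g%:R by rewrite ler1n.
have /choice[P HP] : forall i, exists y : int, ~~ (l %| y)%Z /\ `|y%:~R - zeta i * g%:R| <= 1.
  by move=> i; have [y ? ?] := ndvd_near (zeta i * g%:R) l1; exists y.
exists h, P; rewrite -/g; split => //.
  by apply: near_of => // i; have [] := HP i.
move=> j nj s y sK.
have frac i : g%:R^-1 <= `|(j * P i)%:~R / g%:R + (y i)%:~R| :> R.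
  by apply: ndvd_frac_ge => //; apply: ndvd_mul_pow => //; have [] := HP i.
have ple x : 0 <= x -> g%:R `^ (- x) <= 1 :> R.
  move=> x0; rewrite powRN invf_le1 ?powR_gt0// -[leLHS](powRr0 (g%:R : R)).
  exact: ler_powR.
have [m2|m1] := leqP 2 m.
  exists (Ordinal (m2 : (1 < m)%N)); rewrite mulr0n addr0; apply: le_trans (frac _).
  have -> : - e = - (e - 1) + -1 by ring.
  rewrite powRD; last by apply/implyP => _; rewrite gt_eqF.
  rewrite powR_inv1 ?(ltW g0')// mulrA ler_piMl ?invr_ge0 ?(ltW g0')// powRN.
  rewrite ler_pdivrMr ?powR_gt0// mul1r; apply: le_trans (HN _ _); last by rewrite -(ler_nat R).
  by have := ler_norm L; have := normr_ge0 K; lra.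
(* For [m = 1] no coordinate is free of [s], but then [|s| <= K g ^ (1 - e)] is at most of order
   [g ^ (- 2)], negligible against the gap. *)
have e3 : 3 <= e.
  have m1' : m = 1%N by apply/eqP; rewrite eqn_leq m0 andbT -ltnS.
  by rewrite /e m1' divr1 ler_nat.
exists i0; rewrite eqxx mulr1n.
have := frac i0; set u := _ / _; set v := (y i0)%:~R => huv.
have h5 : `|u + v| <= `|u + s + v| + `|s|.
  have -> : u + v = (u + s + v) - s by ring.
  exact: ler_normB.
have p1 : g%:R `^ (1 - e) <= g%:R^-1 * g%:R^-1 :> R.
  have -> : 1 - e = - (e - 3) + - 2%:R by ring.
  rewrite powRD; last by apply/implyP => _; rewrite gt_eqF.
  rewrite powR_invn ?(ltW g0')// expr2 invfM ler_piMl ?mulr_ge0 ?invr_ge0 ?(ltW g0')//.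
  by apply: ple; lra.
have p2 : g%:R `^ (- e) <= g%:R `^ (1 - e) :> R by apply: ler_powR => //; lra.
have h6 : `|s| <= `|K| * (g%:R^-1 * g%:R^-1).
  apply: le_trans sK _; apply: (@le_trans _ _ (`|K| * g%:R `^ (1 - e))).
    by rewrite ler_wpM2r ?powR_ge0// ler_norm.
  by rewrite ler_wpM2l.
have h7 : L * g%:R `^ (- e) <= `|L| * (g%:R^-1 * g%:R^-1).
  apply: (@le_trans _ _ (`|L| * g%:R `^ (- e))).
    by rewrite ler_wpM2r ?powR_ge0// ler_norm.
  by rewrite ler_wpM2l// (le_trans p2).
have h8 : (`|K| + `|L|) * (g%:R^-1 * g%:R^-1) <= g%:R^-1.
  rewrite mulrA ler_piMl ?invr_ge0 ?(ltW g0')//.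
  by rewrite ler_pdivrMr// mul1r.
move: h5 h6 h7 h8 huv; set A := g%:R^-1 * g%:R^-1; lra.
Qed.

End well_spread.


Lemma sum_ord2 (V : zmodType) (k : 'I_2) (F : 'I_2 -> V) :
  \sum_i F i = F k + F (rev_ord k).
Proof.
rewrite big_ord_recl big_ord1; case: k => -[|[|//]] ?.
  by congr (F _ + F _); apply: val_inj.
by rewrite addrC; congr (F _ + F _); apply: val_inj.
Qed.

Lemma rev_ord2_neq (k : 'I_2) : rev_ord k == k = false.
Proof. by case: k => -[|[|//]] ?; apply/negbTE/eqP => /(congr1 val). Qed.

Lemma ord2_eq_rev (k i : 'I_2) : i != k -> i = rev_ord k.
Proof. by move=> ik; apply: val_inj; move: ik; case: k i => -[|[|//]] ? [[|[|//]] ?]. Qed.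

Section two_columns.
Context {R : realType} {m n : nat}.
Variables (M : 'cV[R]_2 -> R) (N2 : 'cV[R]_m -> R).
Hypothesis (M_norm : is_norm M) (N2_norm : is_norm N2).
Hypothesis (m0 : (0 < m)%N) (n3 : (2 < n)%N) (mn : (m <= n)%N).

Let e : R := n%:R / m%:R.
Let i0 : 'I_m := Ordinal m0.
Let nu (k : 'I_2) := M (delta_mx k 0).
Let f0 : 'cV[R]_m := delta_mx i0 0.
Let kappa := N2 f0.
Let ell (k : 'I_2) := k.+2.

Let norm_delta_gt0 d (N : 'cV[R]_d -> R) k : is_norm N -> 0 < N (delta_mx k 0).
Proof.
move=> nN; rewrite lt_neqAle (is_norm_ge0 nN) andbT eq_sym; apply/eqP => /(is_norm_eq0 nN).
by move=> /colP/(_ k); rewrite !mxE !eqxx => /eqP; rewrite oner_eq0.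
Qed.

Let nu0 k : 0 < nu k. Proof. exact: norm_delta_gt0. Qed.
Let kappa0 : 0 < kappa. Proof. exact: norm_delta_gt0. Qed.
Let ell_prime k : prime (ell k). Proof. by case: k => -[|[|//]]. Qed.
Let ell_coprime k : coprime (ell (rev_ord k)) (ell k). Proof. by case: k => -[|[|//]]. Qed.

(* The relation alternates between the two columns, with denominators that are
   powers of 2 for one column and powers of 3 for the other. *)
Definition alternating_columns (W : 'M[R]_(m, 2)) (b : 'cV[int]_2) : Prop :=
  exists (k : 'I_2) (a : nat) (P : 'I_m -> int),
    [/\ forall i, b i 0 = ((ell k ^ a)%N : int) *+ (i == k),
        forall i, W i k = (P i)%:~R / (ell k ^ a)%:R &
        forall j : int, (forall i, ((ell k ^ a)%N %| j * P i)%Z) -> ((ell k ^ a)%N %| j)%Z].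

Lemma two_column_step : exists2 c0 : R, 0 < c0 & forall c, 0 < c <= c0 ->
  forall W b (eps T : R), alternating_columns W b -> 0 < eps -> exists W' b',
     [/\ alternating_columns W' b', forall i j, `|W' i j - W i j| <= eps,
         T <= M (map_mx intr b') & psi_peak M N2 c e eps W' b b'].
Proof.
have [C1 C10 HC1] := entries_le_norm M_norm.
have [C3 C30 HC3] := entries_le_norm N2_norm.
pose X k := C1 * nu k * (nu k `^ (- e) / kappa).
have X0 k : 0 < X k by rewrite mulr_gt0 ?divr_gt0 ?powR_gt0// mulr_gt0.
(* This gives [c X l <= 1 / 2] for both columns, so the perturbation term [j1 lam] stays at distance
   at least [1 / 2] from nonzero integers. *)
exists (2 * (X ord0 + X ord_max))^-1.
  by rewrite invr_gt0 mulr_gt0// addr_gt0.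
move=> c /andP[c0 cX] W b eps T [k [a [P [bE WP prim]]]] eps0.
have cXk l : c * X l <= 2^-1.
  have h : X l <= X ord0 + X ord_max.
    have [->|->] : l = ord0 \/ l = ord_max.
      by case: l => -[|[|//]] ?; [left|right]; apply: val_inj.
    - by rewrite lerDl ltW.
    - by rewrite lerDr ltW.
  have h2 : 0 < X ord0 + X ord_max by rewrite addr_gt0.
  apply: (@le_trans _ _ (c * (X ord0 + X ord_max))); first by rewrite ler_wpM2l// ltW.
  move: cX; rewrite invfM -ler_pdivlMr ?invr_gt0// invrK; lra.
pose k' := rev_ord k.
pose q : nat := (ell k ^ a)%N.
have q0 : (0 < q)%N by rewrite expn_gt0.
have q0' : (0 : R) < q%:R by rewrite ltr0n.
have q1 : (1 : R) <= q%:R by rewrite ler1n.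
have e1 : 1 <= e by apply: rate_ge1.
have [mu muE] : exists mu, mu = c * nu k' `^ (- e) by eexists.
have mu0 : 0 < mu by rewrite muE mulr_gt0// powR_gt0.
(* [K Q ^ (1 - e)] bounds [|j1 lam|]: the entry [j1] of a vector shorter than [b'] is at most
   [C1 Q nu k'], and [lam = mu Q ^ (- e) / kappa]. *)
pose K := C1 * nu k' * (mu / kappa).
have KX : K = c * X k' by rewrite /K /X muE; ring.
have K0 : 0 <= K by rewrite KX mulr_ge0// ltW.
pose L := q%:R * C3 * mu.
have L0 : 0 < L by rewrite mulr_gt0// mulr_gt0.
pose big := `|T| / nu k' + mu / kappa / eps + 2 * q%:R * C3 * mu + 1.
have [a' [P' [bigQ PW spread]]] :=
  well_spread_point m0 n3 mn (fun i => W i k') K L big (ell_prime k') eps0.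
pose Q : nat := (ell k' ^ a')%N.
rewrite -/Q in bigQ PW spread.
have Q0 : (0 < Q)%N by rewrite expn_gt0.
have Q0' : (0 : R) < Q%:R by rewrite ltr0n.
have Q1 : (1 : R) <= Q%:R by rewrite ler1n.
have [B1 [B2 B3]] : `|T| / nu k' <= Q%:R /\ mu / kappa / eps <= Q%:R /\ 2 * q%:R * C3 * mu <= Q%:R.
  have t1 : 0 <= `|T| / nu k' by rewrite divr_ge0// ltW.
  have t2 : 0 <= mu / kappa / eps by rewrite !divr_ge0// ltW.
  have t3 : 0 <= 2 * q%:R * C3 * mu by rewrite !mulr_ge0 ?(ltW C30) ?(ltW mu0).
  by move: bigQ; rewrite /big; move=> bigQ; split; [|split]; lra.
have Qe0 : 0 < Q%:R `^ (- e) :> R by rewrite powR_gt0.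
have Qe1 : Q%:R `^ (- e) <= Q%:R^-1 :> R.
  by rewrite -powR_inv1 ?(ltW Q0')// ler_powR// lerN2.
have Qe2 : Q%:R `^ (1 - e) <= 1 :> R.
  by rewrite -[leRHS](powRr0 (Q%:R : R)) ler_powR// subr_le0.
have Qe3 : Q%:R `^ (1 - e) = Q%:R * Q%:R `^ (- e) :> R.
  by rewrite powRD ?powRr1 ?(ltW Q0')//; apply/implyP => _; rewrite gt_eqF.
pose b' : 'cV[int]_2 := \col_i ((Q : int) *+ (i == k')).
have Mb' : M (map_mx intr b') = Q%:R * nu k'.
  rewrite -[Q%:R]gtr0_norm// -(is_normZ M_norm); congr M; apply/colP => i.
  by rewrite !mxE andbT; case: eqP; rewrite /= ?mulr1n ?mulr0n ?mulr1 ?mulr0.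
have deltaE : c * M (map_mx intr b') `^ (- e) = mu * Q%:R `^ (- e).
  by rewrite Mb' powRM ?(ltW Q0') ?(ltW (nu0 _))// muE; ring.
have [lam lamE] : exists lam, lam = mu * Q%:R `^ (- e) / kappa by eexists.
have lam0 : 0 < lam by rewrite lamE divr_gt0// mulr_gt0.
(* Column [k] moves at the entry [i0] alone, which gives the old relation the exact value [lam f0].
   The other column becomes rational with denominator [Q] and carries the new relation. *)
pose W' : 'M[R]_(m, 2) := \matrix_(i, l)
  if l == k then ((P i)%:~R + lam *+ (i == i0)) / q%:R else (P' i)%:~R / Q%:R.
have W'k i : W' i k = ((P i)%:~R + lam *+ (i == i0)) / q%:R by rewrite mxE eqxx.
have W'k' i : W' i k' = (P' i)%:~R / Q%:R by rewrite mxE rev_ord2_neq.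
(* Primitivity follows from the spreading property at [s = 0]: if [Q] divided all [j P' i] but not
   [j], a suitable [y] would make every coordinate 0. *)
have prim' (j : int) : (forall i, (Q %| j * P' i)%Z) -> (Q %| j)%Z.
  move=> Hj; apply: contraT => nj.
  have s0 : `|0 : R| <= K * Q%:R `^ (1 - e) by rewrite normr0 mulr_ge0 ?powR_ge0.
  have [i] := spread j nj 0 (fun i => - divz (j * P' i) Q) s0.
  rewrite mul0rn addr0 -{1}(divzK (Hj i)) intrM -pmulrn mulfK ?gt_eqF// intrN subrr normr0.
  by rewrite leNgt mulr_gt0.
exists W', b'; split.
- exists k', a', P'; split => //.
  by move=> i; rewrite mxE.
- move=> i l; have [->|/ord2_eq_rev ->] := eqVneq l k; last by rewrite W'k'.
  rewrite W'k WP -/q -mulrBl [_ + _ - _]addrAC subrr add0r.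
  apply: (@le_trans _ _ lam).
    rewrite normrM normfV [`|q%:R|]gtr0_norm// ler_pdivrMr//.
    apply: (@le_trans _ _ lam); last by rewrite ler_peMr// ltW.
    by case: eqP => _; rewrite ?mulr1n ?mulr0n ?normr0 ?(ltW lam0)// gtr0_norm.
  move: B2; rewrite ler_pdivrMr// => B2.
  rewrite lamE mulrAC; apply: le_trans (ler_wpM2l _ Qe1) _.
    by rewrite divr_ge0// ltW.
  by rewrite ler_pdivrMr// [leRHS]mulrC.
- rewrite Mb'; apply: le_trans (ler_norm T) _.
  by move: B1; rewrite ler_pdivrMr.
split.
  exists (\col_i (- P i)).
  have -> : W' *m map_mx intr b + map_mx intr (\col_i (- P i)) = lam *: f0.
    apply/colP => i; rewrite !mxE (sum_ord2 k) W'k !mxE !bE eqxx rev_ord2_neq mulr0n mulr1n.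
    rewrite mulr0 addr0 -pmulrn divfK ?(gt_eqF q0')// intrN addrAC subrr add0r andbT.
    by case: eqP; rewrite /= ?mulr1 ?mulr0.
  rewrite (is_normZ N2_norm) gtr0_norm// -/kappa lamE divfK ?gt_eqF//.
  rewrite mulrAC deltaE ler_peMr ?mulr_ge0 ?(ltW mu0) ?(ltW Qe0)//.
  by rewrite lerDl ltW.
move=> j y j0 jM; rewrite mulrAC deltaE.
apply: (@le_trans _ _ (mu * Q%:R `^ (- e))).
  by rewrite ler_piMr ?mulr_ge0 ?(ltW mu0) ?(ltW Qe0)// gerBl ltW.
set V := W' *m _ + _.
pose j1 : int := j k 0; pose j2 : int := j k' 0.
have VE i : q%:R * V i 0 =
    (j2 * q%:Z * P' i)%:~R / Q%:R + (j1%:~R * lam) *+ (i == i0) + (j1 * P i + q%:Z * y i 0)%:~R.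
  rewrite /V !mxE (sum_ord2 k) W'k W'k' !mxE -/j1 -/j2 !(intrD, intrM) -!pmulrn.
  by rewrite -mulrnAr; field; rewrite !gt_eqF.
have j1lam : `|j1%:~R * lam| <= K * Q%:R `^ (1 - e).
  have h : `|j1%:~R| <= C1 * (Q%:R * nu k').
    rewrite -Mb'; have := HC1 (map_mx intr j) k; rewrite mxE => /le_trans; apply.
    by rewrite ler_wpM2l// ltW.
  rewrite normrM (gtr0_norm lam0); apply: le_trans (ler_wpM2r (ltW lam0) h) _.
  by rewrite Qe3 /K lamE le_eqVlt; apply/orP; left; apply/eqP; ring.
have lowV (x : R) i : x <= `|q%:R * V i 0| -> x / (q%:R * C3) <= N2 V.
  move=> hx; rewrite ler_pdivrMr ?mulr_gt0//; apply: (le_trans hx).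
  by rewrite normrM gtr0_norm// [leRHS]mulrCA ler_pM2l// mulrC.
have [Qj|nQj] := boolP (Q %| j2 * q%:Z)%Z; last first.
  have [i Hi] := spread _ nQj _ (fun i => j1 * P i + q%:Z * y i 0) j1lam.
  rewrite -VE in Hi; apply: le_trans (lowV _ i Hi).
  by rewrite ler_pdivlMr ?mulr_gt0// /L le_eqVlt; apply/orP; left; apply/eqP; ring.
(* The different primes of the two columns make [q] and [Q] coprime. *)
have {Qj}Qj : (Q %| j2)%Z.
  move: Qj; rewrite Gauss_dvdzl// coprimezE /=.
  by apply: coprimeXl; apply: coprimeXr; exact: ell_coprime.
have /dvdzP[t j2t] := Qj.
pose z i : int := t * q%:Z * P' i + j1 * P i + q%:Z * y i 0.
have {}VE i : q%:R * V i 0 = (z i)%:~R + (j1%:~R * lam) *+ (i == i0).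
  rewrite VE /z j2t !(intrD, intrM) -!pmulrn; field.
  by rewrite gt_eqF.
(* Now the [Q]-fractions are gone: [q V] is an integer vector plus [j1 lam] at [i0]. A nonzero
   integer entry leaves at least [1 / 2]; otherwise only multiples of the old relation's value
   remain. *)
have [/existsP[i zi]|/existsPn z0] := boolP [exists i, z i != 0].
  have hi : 2^-1 <= `|q%:R * V i 0|.
    have j1h : `|(j1%:~R * lam) *+ (i == i0)| <= 2^-1.
      case: (i == i0); last by rewrite mulr0n normr0 invr_ge0.
      rewrite mulr1n; apply: (le_trans j1lam); apply: (@le_trans _ _ K).
        by rewrite ler_piMr.
      by rewrite KX cXk.
    have z1 : 1 <= `|(z i)%:~R| :> R.
      by rewrite -intr_norm (_ : 1 = (1 : int)%:~R)// ler_int -gtz0_ge1 normr_gt0.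
    rewrite VE; have := lerB_normD (z i)%:~R ((j1%:~R * lam) *+ (i == i0)); lra.
  apply: le_trans (lowV _ i hi).
  rewrite ler_pdivlMr ?mulr_gt0//.
  have h2 := ler_wpM2l (ltW mu0) Qe1.
  apply: (@le_trans _ _ (mu * Q%:R^-1 * (q%:R * C3))).
    by rewrite ler_wpM2r// mulr_ge0// ltW.
  rewrite [leLHS](_ : _ = (2 * q%:R * C3 * mu) * 2^-1 / Q%:R); last first.
    by field; rewrite gt_eqF.
  by rewrite ler_pdivrMr// mulrC ler_wpM2l.
have {}z0 i : z i = 0 by apply/eqP; have := z0 i; rewrite negbK.
have qj1 : (q %| j1)%Z.
  apply: prim => i; apply/dvdzP; exists (- (t * P' i + y i 0)).
  apply/eqP; rewrite -subr_eq0; apply/eqP; rewrite -[RHS](z0 i) /z -/q; ring.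
(* Otherwise [j] would be an integer multiple of [b'] that is shorter than [b'], hence 0. *)
have j1n0 : j1 != 0.
  apply: contraNneq j0 => j10.
  have jE : map_mx intr j = (t%:~R * Q%:R) *: delta_mx k' 0 :> 'cV[R]_2.
    apply/colP => i; rewrite !mxE eqxx andbT; have [->|/ord2_eq_rev ->] := eqVneq i k.
      by rewrite -/j1 j10 eq_sym rev_ord2_neq mulr0.
    by rewrite eqxx -/j2 j2t intrM -pmulrn mulr1.
  move: jM; rewrite Mb' jE (is_normZ M_norm) normrM [`|Q%:R|]gtr0_norm// -/(nu k').
  rewrite ltr_pM2r// -[ltRHS]mul1r ltr_pM2r// -intr_norm (_ : 1 = (1 : int)%:~R)// ltr_int.
  rewrite -[1]add0r ltzD1 normr_le0 => /eqP t0.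
  have : map_mx intr j = 0 :> 'cV[R]_2 by rewrite jE t0 mul0r scale0r.
  move=> /colP jz; apply/eqP/colP => i; rewrite mxE; apply/eqP.
  by have := jz i; rewrite !mxE => /eqP; rewrite intr_eq0.
have -> : V = (j1%:~R * lam / q%:R) *: f0.
  apply/colP => i; apply: (mulfI (lt0r_neq0 q0')); rewrite VE z0 add0r mxE /f0 mxE eqxx andbT.
  rewrite [RHS](_ : _ = j1%:~R * lam * (i == i0)%:R); first by rewrite mulr_natr.
  by field; rewrite gt_eqF.
rewrite (is_normZ N2_norm) -/kappa normrM normfV [`|q%:R|]gtr0_norm// normrM (gtr0_norm lam0).
have -> : mu * Q%:R `^ (- e) = lam * kappa by rewrite lamE divfK ?gt_eqF.
have hq : q%:R <= `|j1%:~R| :> R.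
  have /dvdzP[x j1x] := qj1; rewrite j1x intrM normrM -pmulrn [`|q%:R|]gtr0_norm//.
  rewrite ler_peMl// -intr_norm (_ : 1 = (1 : int)%:~R)// ler_int -gtz0_ge1 normr_gt0.
  by apply: contraNneq j1n0 => x0; rewrite j1x x0 mul0r.
rewrite [leRHS](_ : _ = lam * kappa * (`|j1%:~R| / q%:R)); last ring.
by rewrite ler_peMr ?mulr_ge0 ?(ltW lam0) ?(ltW kappa0)// ler_pdivlMr// mul1r.
Qed.

Lemma two_columns_extensible : exists2 c0 : R, 0 < c0 &
  forall c, 0 < c <= c0 -> extensible_peaks M N2 c e.
Proof.
have [c0 c00 H] := two_column_step; exists c0 => // c cc.
exists alternating_columns, 0, (delta_mx ord0 0); split.
  exists ord0, 0%N, (fun=> 0); split => [i|i|j _].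
  - by rewrite mxE eqxx andbT; case: eqP.
  - by rewrite mxE mul0r.
  - by rewrite expn0 dvd1z.
exact: H.
Qed.

End two_columns.

(** * Hausdorff dimension of FS *)


Lemma hausdorff_dim_ge0 (R : realType) (V : normedModType R) (A : set V) :
  (0 <= hausdorff_dim A)%E.
Proof. by apply: le_ereal_inf_tmp => _ [s [s0 _] <-]; rewrite lee_fin. Qed.

Section assembly.
Context {R : realType} {m p q : nat}.
Hypothesis (m0 : (0 < m)%N) (p0 : (0 < p)%N) (q0 : (0 < q)%N).
Variables (N1 : 'cV[R]_(p + q) -> R) (N2 : 'cV[R]_m -> R).
Hypothesis (N1_norm : is_norm N1) (N2_norm : is_norm N2).

Let e : R := (p + q)%:R / m%:R.
Let emb d (b : 'cV[int]_d) : 'cV[int]_(p + d) := col_mx 0 b.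

Definition tail_norm (v : 'cV[R]_q) : R := N1 (col_mx 0 v).

Lemma tail_norm_is_norm : is_norm tail_norm.
Proof.
split=> [x|x /(is_norm_eq0 N1_norm)|a x|x y]; rewrite /tail_norm.
- exact: is_norm_ge0.
- by move=> /(congr1 dsubmx); rewrite col_mxKd linear0.
- by rewrite -(is_normZ N1_norm) scale_col_mx scaler0.
- by rewrite -{1}[0](addr0 0) -add_col_mx (is_normD N1_norm).
Qed.

Lemma map_emb (b : 'cV[int]_q) :
  map_mx intr (emb b) = col_mx 0 (map_mx intr b) :> 'cV[R]_(p + q).
Proof.
rewrite map_col_mx; congr (col_mx _ _).
by apply/matrixP => i j; rewrite !mxE.
Qed.

Lemma psi_value_row_mx (X : 'M[R]_(m, p)) (W : 'M[R]_(m, q)) (x : 'cV[int]_p)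
    (j : 'cV[int]_q) (y : 'cV[int]_m) :
  psi_value N2 (row_mx X W) (col_mx x j, y) =
  N2 (X *m map_mx intr x + W *m map_mx intr j + map_mx intr y).
Proof. by rewrite /psi_value /= map_col_mx mul_row_col. Qed.

Lemma map_intr0 d : map_mx intr (0 : 'cV[int]_d) = 0 :> 'cV[R]_d.
Proof. by apply/matrixP => i j; rewrite !mxE. Qed.

(** With [W = 0] every vector supported on the last columns is an exact relation, so any [X] works
    and only the lengths of the relations matter. *)
Lemma FS0_dim (A : set 'M[R]_(m, p + q)) :
  (forall Omega, FS N1 N2 0 Omega -> A Omega) ->
  (((m * p)%:R : R)%:E <= hausdorff_dim A)%E.
Proof.
move=> HA; apply: (@hausdorff_dim_ge _ _ _ _ 0 A (fun _ _ => True)).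
  move=> l rho r0 k0; exists k0 => //; exists 0%N => N _.
  rewrite (_ : #|_| = N ^ (m * p))%N ?leq_pmull// -[in RHS](card_ord N) -card_mx.
  by apply: eq_card => a; rewrite !inE; apply/asboolP.
move=> X _; apply: HA; pose j0 : 'I_q := Ordinal q0.
have mu0 : 0 < tail_norm (delta_mx j0 0).
  rewrite lt_neqAle (is_norm_ge0 tail_norm_is_norm) andbT eq_sym.
  apply/eqP => /(is_norm_eq0 tail_norm_is_norm)/colP/(_ j0).
  by rewrite !mxE !eqxx => /eqP; rewrite oner_eq0.
set mu := tail_norm _ in mu0.
(* [D] brings the first length up to 1; the factorial then multiplies the lengths by exactly
   [k + 2]. *)
pose D := (Num.truncn mu^-1).+1.
pose b k : 'cV[int]_q := ((D * k.+1`!)%N : int) *: delta_mx j0 0.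
have Tb k : N1 (map_mx intr (emb (b k))) = (D * k.+1`!)%:R * mu.
  rewrite map_emb -[_%:R]gtr0_norm; last by rewrite ltr0n muln_gt0 fact_gt0.
  rewrite -/(tail_norm _) -(is_normZ tail_norm_is_norm); congr tail_norm.
  by apply/colP => i; rewrite !mxE intrM -pmulrn; case: eqP; rewrite /= ?mulr1 ?mulr0.
apply: (@FS_criterion _ _ _ m0 _ _ _ N1_norm _ 0 (fun k => emb (b k)) (fun=> 0)) => //.
- by rewrite addn_gt0 p0.
- rewrite Tb -ler_pdivrMr// mul1r (le_trans (ltW (truncnS_gt _)))// ler_nat.
  by rewrite leq_pmulr.
- by move=> k; rewrite !Tb factS mulrA -natrM mulnCA.
- move=> k; rewrite /emb psi_value_row_mx !map_intr0 mulmx0 mul0mx !addr0.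
  by rewrite (is_norm0 N2_norm) !mul0r.
- by move=> k0; exists k0 => // v _ _; rewrite !mul0r (is_norm_ge0 N2_norm).
Qed.

(** Stated for every superset [A] of the [FS] set, so that it applies to [DI] as well without a
    separate monotonicity argument. *)
Lemma FS_dim : (exists2 c1 : R, 0 < c1 & forall c, 0 < c <= c1 ->
    extensible_peaks tail_norm N2 c e) ->
  exists2 c0 : R, 0 < c0 & forall c, 0 <= c <= c0 -> forall A : set 'M[R]_(m, p + q),
    (forall Omega, FS N1 N2 c Omega -> A Omega) ->
    (((m * p)%:R : R)%:E <= hausdorff_dim A)%E.
Proof.
move=> [c1 c10 ext]; have [c2 c20 half] := half_avoiding (q := q) m0 p0 N1_norm N2_norm.
exists (Num.min c1 c2); first by rewrite lt_min c10 c20.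
move=> c /andP[c_ge0]; rewrite le_min => /andP[cc1 cc2] A HA.
have [c0|c0|c0] := ltgtP 0 c; last by apply: FS0_dim; rewrite c0.
  2: by move: c_ge0; rewrite leNgt c0.
have [|W [b [T0 TS peak]]] := iterate_peaks tail_norm_is_norm N2_norm c0 (ext c _).
  by rewrite c0.
pose T k := tail_norm (map_mx intr (b k)).
have TE k : N1 (map_mx intr (emb (b k))) = T k by rewrite map_emb.
have T_ge k : k.+1%:R <= T k.
  elim: k => [|k IH]; first exact: T0.
  apply: le_trans (TS k); rewrite -[leLHS]mulr1 ler_wpM2l//.
  by rewrite (le_trans _ IH)// ler1n.
have /choice[y Hy] : forall k, exists y : 'cV[int]_m,
    N2 (W *m map_mx intr (b k) + map_mx intr y) <=
    c * (1 + k.+1%:R^-1) * T k.+1 `^ (- e).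
  by move=> k; have [] := peak k.
apply: (@hausdorff_dim_ge _ _ _ _ W A
  (fun k => avoids N1 N2 W (T k.+1) (c * T k.+1 `^ (- e)))).
  move=> l rho r0 k0; have [|X0 HX0] := half c _ W l rho r0; first by rewrite c0.
  exists (maxn k0 (Num.truncn X0)); first by rewrite leq_maxl.
  apply: HX0; apply: le_trans (T_ge _); rewrite (le_trans (ltW (truncnS_gt _)))//.
  by rewrite ler_nat ltnS leqW// leq_maxr.
move=> X XG; apply: HA.
apply: (@FS_criterion _ _ _ m0 _ _ _ N1_norm _ c (fun k => emb (b k)) y) => //.
- by rewrite addn_gt0 p0.
- by rewrite TE.
- by move=> k; rewrite !TE.
- by move=> k; rewrite TE /emb psi_value_row_mx map_intr0 mulmx0 add0r.
move=> k0; have [k kk0 Hk] := XG k0; exists k => // -[v z] /= v0; rewrite TE => vT.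
have P0 : 0 <= c * T k.+1 `^ (- e) by rewrite mulr_ge0 ?powR_ge0.
rewrite -(vsubmxK v) psi_value_row_mx; rewrite -(vsubmxK v) in v0 vT.
(* A nonzero [X]-part is handled by the choice of [X], a zero one by the peak of [W]. *)
have [x0|x0] := eqVneq (usubmx v) 0; last first.
  apply: le_trans (Hk _ _ z x0 vT); rewrite mulrAC ler_piMr// gerBl invr_ge0 //.
rewrite x0 map_intr0 mulmx0 add0r; have [_] := peak k; apply.
  by apply: contraNneq v0 => j0; rewrite x0 j0 col_mx0.
by rewrite x0 -/(emb _) map_emb in vT.
Qed.

End assembly.

Theorem theorem10p1 (R : realType) (m n : nat)
    (m_gt0 : (0 < m)%N) (n_gt0 : (0 < n)%N)
    (N1 : 'cV[R]_n -> R) (N2 : 'cV[R]_m -> R)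
    (N1_norm : is_norm N1) (N2_norm : is_norm N2) :
  exists c0 : R, 0 < c0 /\
    forall c : R, 0 <= c <= c0 ->
      [/\ m <> n -> (m, n) <> (1%N, 3%N) ->
            ((m%:R * (n%:R - 2))%:E <= hausdorff_dim (FS N1 N2 c))%E,
          m = n ->
            ((n%:R * (n%:R - 2))%:E <= hausdorff_dim (DI N1 N2 c))%E
        & (n < m)%N ->
            ((m%:R * (n%:R - 1))%:E <= hausdorff_dim (FS N1 N2 c))%E].
Proof.
have trivial_bound (V : normedModType R) (A : set V) (x : R) : x <= 0 ->
    (x%:E <= hausdorff_dim A)%E.
  by move=> x0; apply: le_trans (hausdorff_dim_ge0 _); rewrite lee_fin.
have [n2|n2] := ltnP n 2.
  have n1 : n%:R = 1 :> R by rewrite (_ : n = 1%N)//; apply/eqP; rewrite eqn_leq n_gt0 andbT.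
  exists 1; split => // c _; split => *; apply: trivial_bound; rewrite n1;
    have := ler0n R m; lra.
have [nm|mn] := ltnP n m.
  have [p np] : exists p, n = (p + 1)%N by exists n.-1; rewrite addn1 prednK.
  subst n.
  have p0 : (0 < p)%N by move: n2; rewrite addn1 ltnS.
  have nN := tail_norm_is_norm N1_norm.
  have [c0 c00 Hc0] := FS_dim m_gt0 p0 (ltn0Sn 0) N1_norm N2_norm
    (one_column_extensible nN N2_norm n2 nm).
  exists c0; split => // c cc; have H := Hc0 c cc _ (fun _ h => h).
  split => [_ _|mn|_].
  - apply: le_trans H; rewrite lee_fin natrM ler_wpM2l// natrD; lra.
  - by rewrite mn ltnn in nm.
  - by apply: le_trans H; rewrite lee_fin natrM natrD addrK.
(* Here [n = 2], so freezing two columns would leave nothing; the claimed bounds are 0. *)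
have [n3|n3] := ltnP n 3.
  have n2' : n%:R - 2 = 0 :> R.
    by rewrite (_ : n = 2%N) ?subrr//; apply/eqP; rewrite eqn_leq n2 andbT.
  exists 1; split => // c _; split => [_ _|_|//].
    by apply: trivial_bound; rewrite n2' mulr0.
  by apply: trivial_bound; rewrite n2' mulr0.
have [p np] : exists p, n = (p + 2)%N by exists (n - 2)%N; rewrite subnK.
subst n.
have p0 : (0 < p)%N by move: n3; rewrite addn2 !ltnS.
have nN := tail_norm_is_norm N1_norm.
have [c0 c00 Hc0] := FS_dim m_gt0 p0 (ltn0Sn 1) N1_norm N2_norm
  (two_columns_extensible nN N2_norm m_gt0 n3 mn).
exists c0; split => // c cc; have H := Hc0 c cc.
split => [_ _|mE|//].
  by apply: le_trans (H _ (fun _ h => h)); rewrite lee_fin natrM natrD addrK.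
have := H (DI N1 N2 c) (fun _ h => proj1 h); apply: le_trans.
by rewrite lee_fin natrM -mE [in X in _ * (X - _)]mE natrD addrK.
Qed.
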